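(* With respect to the max stratification, $\mathrm{Spec}^{\mathrm{max}}_1(F)=\{\mathbb{Z}\}$, and for any $k\ge 2$ we have $\mathbb{Z}\notin \mathrm{Spec}^{\mathrm{max}}_k(F)$.
   Context: Thompson's group $F$ is the group, under composition, of orientation-preserving piecewise-linear homeomorphisms of $[0,1]$ with finitely many breakpoints, all at dyadic rationals, and all slopes powers of $2$. Tree pairs: a caret is a pair of edges joining two vertices to a common parent. A finite rooted binary tree with $n$ carets (internal nodes) has $n+1$ leaves, numbered from left to right; it determines a subdivision of $[0,1]$ into $n+1$ dyadic intervals, one per leaf (the root corresponds to $[0,1]$, and each caret divides its interval in half). An $n$-caret tree pair $(S,T)$ is an ordered pair of rooted binary trees each with $n$ carets; it represents the element of $F$ mapping the interval of the $i$-th leaf of $S$ affinely onto the interval of the $i$-th leaf of $T$. An exposed caret is a caret both of whose children are leaves. A tree pair with at least two carets in each tree is unreduced if, for some $k$, both trees contain an exposed caret with leaves numbered $k,k+1$; otherwise it is reduced. Every element of $F$ is represented by a unique nonempty reduced tree pair (the identity by the pair of single carets). The size $|t|$ of a reduced tree pair $t$ is the number of carets in either of its trees. Let $X_k$ be the set of unordered $k$-tuples (repetitions allowed) of nonempty reduced tree pairs. In the max stratification, $\mathrm{Sph}^{\mathrm{max}}_k(n)=\{(t_1,\ldots,t_k)\in X_k : \max_i |t_i|=n\}$. The (asymptotic) density of $T\subseteq X_k$ is $\lim_{n\to\infty} \frac{|T\cap \mathrm{Sph}^{\mathrm{max}}_k(n)|}{|\mathrm{Sph}^{\mathrm{max}}_k(n)|}$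 if this limit exists. For a subgroup $H$ of $F$ let $T_H\subseteq X_k$ be the set of $k$-tuples whose coordinates generate a subgroup of $F$ isomorphic to $H$; $H$ is visible if the density of $T_H$ is positive. $\mathrm{Spec}^{\mathrm{max}}_k(F)$ is the set of visible isomorphism classes of subgroups of $F$ with respect to the max stratification. *)

(* Defs.v *)
From HB Require Import structures.
From mathcomp Require Import all_boot all_order all_algebra.
From mathcomp Require Import finmap multiset.
From mathcomp Require Import all_classical all_reals all_analysis.

Set Implicit Arguments.
Unset Strict Implicit.
Unset Printing Implicit Defensive.

Import Order.TTheory GRing.Theory Num.Theory.
Import numFieldNormedType.Exports.

Local Open Scope classical_set_scope.
Local Open Scope ring_scope.

Definition unit_interval (R : realType) : set R := `[0%R, 1%R]%classic.
Arguments unit_interval R : clear implicits.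

Definition homeomorphism {X Y : topologicalType} (f : X -> Y) : Prop :=
  continuous f /\ exists g : Y -> X, [/\ continuous g, cancel f g & cancel g f].

Definition dyadic {R : realType} (x : R) : Prop :=
  exists (m : int) (n : nat), x = m%:~R / 2 ^+ n.

(* The points of [s] cut [0, 1] into pieces; on each piece [f] is affine with
   slope a power of 2.  Not every point of [s] has to be a breakpoint. *)
Definition pl_dyadic {R : realType} (f : unit_interval R -> unit_interval R) :
  Prop :=
  exists s : seq R,
    {in s, forall b, dyadic b} /\
    forall x y : unit_interval R, \val x <= \val y ->
      {in s, forall b, ~~ (\val x < b < \val y)} ->
      exists (e : int) (c : R), forall z : unit_interval R,
        \val x <= \val z <= \val y -> \val (f z) = 2 ^ e * \val z + c.

Definition in_thompson {R : realType}
    (f : unit_interval R -> unit_interval R) : Prop :=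
  [/\ homeomorphism f,
      {homo f : x y / \val x < \val y} &
      pl_dyadic f].

Record thompson (R : realType) := Thompson {
  thompson_fun :> unit_interval R -> unit_interval R;
  thompsonP : in_thompson thompson_fun }.

HB.instance Definition _ (R : realType) := gen_eqMixin (thompson R).
HB.instance Definition _ (R : realType) := gen_choiceMixin (thompson R).

Section ThompsonGroup.
Context {R : realType}.
Local Notation I := (set_type (unit_interval R)).
Implicit Types (f g : I -> I) (x y z : I) (a b c : R) (s : seq R).

Lemma thompson_eq (f g : thompson R) : f =1 g -> f = g.
Proof.
case: f g => [f fP] [g gP] /= /funext E.
by move: gP; rewrite -E => gP; congr Thompson; exact: Prop_irrelevance.
Qed.

Lemma dyadicD a b : dyadic a -> dyadic b -> dyadic (a + b).
Proof.
move=> [m [n ->]] [m' [n' ->]].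
exists (m * 2 ^+ n' + m' * 2 ^+ n), (n + n')%N.
rewrite exprD rmorphD/= !rmorphM/= !rmorphXn/= mulrDl.
have h k : (2 : R) ^+ k != 0 by rewrite expf_neq0// pnatr_eq0.
rewrite invfM; congr (_ + _).
  by rewrite mulrACA divff// mulr1.
by rewrite (mulrC (_^-1)) mulrACA divff// mulr1.
Qed.

Lemma dyadicN a : dyadic a -> dyadic (- a).
Proof. by move=> [m [n ->]]; exists (- m), n; rewrite rmorphN mulNr. Qed.

Lemma dyadicB a b : dyadic a -> dyadic b -> dyadic (a - b).
Proof. by move=> da db; apply/dyadicD/dyadicN. Qed.

Lemma dyadicZ (e : int) a : dyadic a -> dyadic (2 ^ e * a).
Proof.
move=> [m [n ->]]; case: e => k.
  exists (2 ^+ k * m), n.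
  by rewrite rmorphM/= rmorphXn/= -exprnP mulrA.
exists m, (n + k.+1)%N.
by rewrite NegzE -exprnN exprD invfM mulrCA; congr (_ * _); rewrite mulrC.
Qed.

Lemma dyadic0 : dyadic (0 : R).
Proof. by exists 0, 0%N; rewrite mul0r. Qed.

Lemma unitIP x : 0 <= \val x <= 1.
Proof. by have := valP x; rewrite inE /unit_interval /= in_itv. Qed.

Lemma unitI_lift b : 0 <= b <= 1 -> exists x, \val x = b.
Proof.
move=> hb; have h : b \in unit_interval R by rewrite inE /unit_interval /= in_itv.
by exists (Sub b h).
Qed.

Lemma thompson_mono f : in_thompson f ->
  {mono f : x y / \val x < \val y} /\ {mono f : x y / \val x <= \val y}.
Proof.
move=> [_ fhomo _].
have H : {mono f : x y / \val x < \val y}.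
  move=> x y; apply/idP/idP; last exact: fhomo.
  apply: contraTT; rewrite -!leNgt le_eqVlt => /orP[/eqP/val_inj->//|/fhomo].
  exact: ltW.
by split=> // x y; rewrite !leNgt H.
Qed.

Lemma thompson_0 f x : in_thompson f -> \val x = 0 -> \val (f x) = 0.
Proof.
move=> ft x0; have [_ fm] := thompson_mono ft.
case: ft => -[_ [g [_ fK gK]]] _ _.
apply/eqP; rewrite eq_le; case/andP: (unitIP (f x)) => -> _; rewrite andbT.
have [u u0] : exists u : I, \val u = 0 by apply: unitI_lift; rewrite lexx ler01.
by rewrite -[leRHS]u0 -(gK u) fm x0; case/andP: (unitIP (g u)).
Qed.

Lemma ltn_count_sub s (P Q : pred R) b : b \in s -> Q b -> ~~ P b ->
  (forall a, P a -> Q a) -> (count P s < count Q s)%N.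
Proof.
move=> + Qb /negbTE Pb PQ; elim: s => //= d s IH.
rewrite inE => /orP[/eqP<-|/IH {}IH].
  by rewrite Pb Qb add0n ltnS sub_count.
by rewrite -addnS leq_add//; case: (boolP (P d)) => [/PQ->|].
Qed.

Lemma thompson_dyadic f x : in_thompson f -> dyadic (\val x) ->
  dyadic (\val (f x)).
Proof.
move=> ft dx; have [fl fm] := thompson_mono ft.
have [u u0] : exists u : I, \val u = 0 by apply: unitI_lift; rewrite lexx ler01.
have f0 := thompson_0 ft u0.
case: (ft) => _ _ [s [ds fs]].
suff H n : forall y z, \val y <= \val z -> dyadic (\val y) -> dyadic (\val z) ->
    (count (fun b => \val y < b < \val z)%R s < n)%N ->
    dyadic (\val (f z) - \val (f y)).
  have := H _ u x _ _ dx (ltnSn _).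
  by rewrite f0 subr0 u0; apply; [case/andP: (unitIP x)|exact: dyadic0].
elim: n => // n IH y z yz dy dz cn.
have [/hasP[b bs /andP[yb bz]]|nb] :=
  boolP (has (fun b => \val y < b < \val z) s).
  have [b' b'E] : exists b' : I, \val b' = b.
    apply: unitI_lift; case/andP: (unitIP y) => y0 _; case/andP: (unitIP z) => _ z1.
    by rewrite (le_trans y0 (ltW yb)) (le_trans (ltW bz)).
  have -> : \val (f z) - \val (f y) =
      (\val (f z) - \val (f b')) + (\val (f b') - \val (f y)).
    by rewrite addrA subrK.
  have db := ds _ bs.
  apply: dyadicD; apply: IH; rewrite ?b'E ?(ltW yb) ?(ltW bz)//;
    rewrite -ltnS; apply: (leq_trans _ cn); rewrite ltnS; apply: (@ltn_count_sub _ _ _ b) => //=;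
    rewrite ?yb ?bz ?ltxx ?andbF// => a /andP[p q]; apply/andP; split=> //.
    exact: lt_trans p.
  exact: lt_trans bz.
have [e [c H]] : exists (e : int) (c : R), forall t : I,
    \val y <= \val t <= \val z -> \val (f t) = 2 ^ e * \val t + c.
  apply: fs => // b bs; apply: contra nb => h; by apply/hasP; exists b.
rewrite !H ?lexx ?yz// opprD addrACA subrr addr0 -mulrBr.
exact/dyadicZ/dyadicB.
Qed.

Lemma thompson_dyadicV f x : in_thompson f -> dyadic (\val (f x)) ->
  dyadic (\val x).
Proof.
move=> ft dx; have [fl fm] := thompson_mono ft.
have [u u0] : exists u : I, \val u = 0 by apply: unitI_lift; rewrite lexx ler01.
case: (ft) => _ _ [s [ds fs]].
suff H n : forall y, \val y <= \val x -> dyadic (\val y) ->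
    (count (fun b => \val y < b < \val x)%R s < n)%N -> dyadic (\val x).
  apply: (H _ u _ _ (ltnSn _)); rewrite u0; [by case/andP: (unitIP x)|exact: dyadic0].
elim: n => // n IH y yx dy cn.
have [/hasP[b bs /andP[yb bx]]|nb] :=
  boolP (has (fun b => \val y < b < \val x) s).
  have [b' b'E] : exists b' : I, \val b' = b.
    apply: unitI_lift; case/andP: (unitIP y) => y0 _; case/andP: (unitIP x) => _ z1.
    by rewrite (le_trans y0 (ltW yb)) (le_trans (ltW bx)).
  apply: (IH b'); rewrite ?b'E ?(ltW bx)//; first exact: ds.
  rewrite -ltnS; apply: (leq_trans _ cn); rewrite ltnS; apply: (@ltn_count_sub _ _ _ b) => //=;
    rewrite ?yb ?bx ?ltxx// => a /andP[p q]; apply/andP; split=> //.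
  exact: lt_trans p.
have [e [c H]] : exists (e : int) (c : R), forall t : I,
    \val y <= \val t <= \val x -> \val (f t) = 2 ^ e * \val t + c.
  apply: fs => // b bs; apply: contra nb => h; by apply/hasP; exists b.
have E : \val (f x) - \val (f y) = 2 ^ e * (\val x - \val y).
  by rewrite !H ?lexx ?yx// opprD addrACA subrr addr0 -mulrBr.
have -> : \val x = 2 ^ (- e) * (\val (f x) - \val (f y)) + \val y.
  by rewrite E mulrA -expfzDr ?pnatr_eq0// addNr expr0z mul1r subrK.
by apply: dyadicD => //; apply/dyadicZ/dyadicB => //; exact: thompson_dyadic.
Qed.

Lemma in_thompson_id : in_thompson (@idfun I).
Proof.
have cid : continuous (@idfun I) by move=> x; exact: cvg_id.
split=> //; first by split=> //; exists idfun.
exists [::]; split=> // x y _ _; exists 0, 0 => z _.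
by rewrite expr0z mul1r addr0.
Qed.

Lemma in_thompson_comp f g : in_thompson f -> in_thompson g ->
  in_thompson (f \o g).
Proof.
move=> ft gt; have [gl gm] := thompson_mono gt.
case: (ft) => -[cf [f' [cf' fK f'K]]] fh [sf [dsf pf]].
case: (gt) => -[cg [g' [cg' gK g'K]]] gh [sg [dsg pg]].
split.
- split; first by move=> x; apply: continuous_comp; [exact: cg|exact: cf].
  exists (g' \o f'); split; last 2 first.
  + by move=> x /=; rewrite fK gK.
  + by move=> x /=; rewrite g'K f'K.
  + by move=> x; apply: continuous_comp; [exact: cf'|exact: cg'].
- by move=> x y xy; apply/fh/gh.
exists (sg ++ [seq \val (g' b) | b : I <- pmap insub sf]); split.
  move=> b; rewrite mem_cat => /orP[/dsg//|/mapP[b' b's ->]].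
  apply: (thompson_dyadicV gt); rewrite g'K; apply: dsf.
  by move: b's; rewrite mem_pmap_sub.
move=> x y xy H.
have [b bs|e [c gE]] := pg x y xy.
  by apply: H; rewrite mem_cat bs.
have [|b bs|e' [c' fE]] := pf (g x) (g y).
- by rewrite gm.
- apply/negP => /andP[xb yb].
  have [b' b'E] : exists b' : I, \val b' = b.
    apply: unitI_lift; case/andP: (unitIP (g x)) => y0 _.
    case/andP: (unitIP (g y)) => _ z1.
    by rewrite (le_trans y0 (ltW xb)) (le_trans (ltW yb)).
  have /H/negP[] : \val (g' b') \in sg ++ [seq \val (g' b) | b : I <- pmap insub sf].
    rewrite mem_cat; apply/orP; right; apply: map_f.
    by rewrite mem_pmap_sub b'E.
  by rewrite -(gl x) -(gl _ y) g'K b'E xb yb.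
exists (e' + e), (2 ^ e' * c + c') => z /andP[xz zy].
rewrite /= fE ?gm ?xz ?zy// gE ?xz ?zy// expfzDr ?pnatr_eq0//.
by rewrite mulrDr mulrA addrA.
Qed.

Lemma in_thompson_inv f g : in_thompson f -> cancel f g -> cancel g f ->
  in_thompson g.
Proof.
move=> ft fK gK; have [fl fm] := thompson_mono ft.
case: (ft) => -[cf [g' [cg' fK' gK']]] fh [s [ds pf]].
have E : g = g' by apply/funext => x; rewrite -[in RHS](gK x) fK'.
have gl : {mono g : x y / \val x < \val y} by move=> x y; rewrite -fl !gK.
have gm : {mono g : x y / \val x <= \val y} by move=> x y; rewrite -fm !gK.
split.
- by split; [rewrite E|exists f].
- by move=> x y; rewrite gl.
exists [seq \val (f b) | b : I <- pmap insub s]; split.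
  move=> _ /mapP[b bs ->]; apply: (thompson_dyadic ft); apply: ds.
  by move: bs; rewrite mem_pmap_sub.
move=> x y xy H.
have [|b bs|e [c fE]] := pf (g x) (g y).
- by rewrite gm.
- apply/negP => /andP[xb yb].
  have [b' b'E] : exists b' : I, \val b' = b.
    apply: unitI_lift; case/andP: (unitIP (g x)) => y0 _.
    case/andP: (unitIP (g y)) => _ z1.
    by rewrite (le_trans y0 (ltW xb)) (le_trans (ltW yb)).
  have /H/negP[] : \val (f b') \in [seq \val (f b) | b : I <- pmap insub s].
    by apply: map_f; rewrite mem_pmap_sub b'E.
  by rewrite -(gl x) -(gl _ y) fK b'E xb yb.
exists (- e), (- (2 ^ (- e) * c)) => z /andP[xz zy].
rewrite -[in X in _ = _ * X + _](gK z) fE ?gm ?xz ?zy//.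
by rewrite mulrDr mulrA -expfzDr ?pnatr_eq0// addNr expr0z mul1r addrK.
Qed.

Definition thompson_one : thompson R := Thompson in_thompson_id.

Definition thompson_mul (f g : thompson R) : thompson R :=
  Thompson (in_thompson_comp (thompsonP f) (thompsonP g)).

Lemma thompson_inv_ex (f : thompson R) :
  exists g : thompson R, cancel f g /\ cancel g f.
Proof.
have [[_ [g [_ fK gK]]] _ _] := thompsonP f.
by exists (Thompson (in_thompson_inv (thompsonP f) fK gK)).
Qed.

Definition thompson_inv (f : thompson R) : thompson R :=
  projT1 (cid (thompson_inv_ex f)).

Lemma thompson_mulA : associative thompson_mul.
Proof. by move=> f g h; exact: thompson_eq. Qed.

Lemma thompson_mul1 : left_id thompson_one thompson_mul.
Proof. by move=> f; exact: thompson_eq. Qed.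

Lemma thompson_mul1r : right_id thompson_one thompson_mul.
Proof. by move=> f; exact: thompson_eq. Qed.

Lemma thompson_mulV : left_inverse thompson_one thompson_inv thompson_mul.
Proof.
move=> f; apply: thompson_eq => x /=; rewrite /thompson_inv.
by case: cid => g [fK gK] /=; rewrite fK.
Qed.

Lemma thompson_mulVr : right_inverse thompson_one thompson_inv thompson_mul.
Proof.
move=> f; apply: thompson_eq => x /=; rewrite /thompson_inv.
by case: cid => g [fK gK] /=; rewrite gK.
Qed.

HB.instance Definition _ := isGroup.Build (thompson R)
  thompson_mulA thompson_mul1 thompson_mul1r thompson_mulV thompson_mulVr.

End ThompsonGroup.

Definition subgroup {G : groupType} (H : set G) : Prop :=
  group_closed (mem H).

Definition generated {G : groupType} (A : set G) : set G := smallest subgroup A.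

(* Isomorphism between two subgroups of possibly different groups. *)
Definition isomorphic {G G' : groupType} (H : set G) (K : set G') : Prop :=
  exists2 phi : G -> G', set_bij H K phi &
    {in H &, {morph phi : x y / (x * y)%g}}.

Inductive btree := Leaf | Caret of btree & btree.

Fixpoint gentree_of_btree (t : btree) : GenTree.tree unit :=
  match t with
  | Leaf => GenTree.Leaf tt
  | Caret l r => GenTree.Node 0 [:: gentree_of_btree l; gentree_of_btree r]
  end.

Fixpoint btree_of_gentree (t : GenTree.tree unit) : option btree :=
  match t with
  | GenTree.Leaf _ => Some Leaf
  | GenTree.Node _ [:: l; r] =>
      if (btree_of_gentree l, btree_of_gentree r) is (Some l', Some r')
      then Some (Caret l' r') else None
  | _ => None
  end.

Lemma gentree_of_btreeK : pcancel gentree_of_btree btree_of_gentree.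
Proof. by elim=> //= l -> r ->. Qed.

HB.instance Definition _ := Countable.copy btree (pcan_type gentree_of_btreeK).

Fixpoint carets (t : btree) : nat :=
  if t is Caret l r then (carets l + carets r).+1 else 0%N.

Fixpoint leaves (t : btree) : nat :=
  if t is Caret l r then (leaves l + leaves r)%N else 1%N.

(* The numbers of the left leaves of the exposed carets of [t], when the
   leftmost leaf of [t] is numbered [k]. *)
Fixpoint exposed (k : nat) (t : btree) : seq nat :=
  match t with
  | Leaf => [::]
  | Caret Leaf Leaf => [:: k]
  | Caret l r => exposed k l ++ exposed (k + leaves l) r
  end.

Definition unreduced (p : btree * btree) : bool :=
  [&& (2 <= carets p.1)%N, (2 <= carets p.2)%N &
      has (mem (exposed 0 p.2)) (exposed 0 p.1)].

(* Nonempty means having at least one caret. *)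
Definition nonempty_reduced (p : btree * btree) : bool :=
  [&& carets p.1 == carets p.2, (0 < carets p.1)%N & ~~ unreduced p].

Definition tree_pair := {p : btree * btree | nonempty_reduced p}.

Definition tree_pair_size (t : tree_pair) : nat := carets (val t).1.

(* The subdivision of [a, b] determined by [t], as the list of the endpoint
   pairs of its intervals, from left to right. *)
Fixpoint leaf_intervals {R : realType} (t : btree) (a b : R) : seq (R * R) :=
  if t is Caret l r
  then leaf_intervals l a ((a + b) / 2) ++ leaf_intervals r ((a + b) / 2) b
  else [:: (a, b)].

Definition represents {R : realType} (t : tree_pair) (f : thompson R) : Prop :=
  forall i : nat, (i < leaves (val t).1)%N ->
    let: (a, b) := nth (0, 0) (leaf_intervals (val t).1 0 1) i in
    let: (c, d) := nth (0, 0) (leaf_intervals (val t).2 0 1) i in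
    forall x : unit_interval R, a <= \val x <= b ->
      \val (f x) = c + (d - c) / (b - a) * (\val x - a).

(* An unordered k-tuple is a multiset with k elements, multiplicities counted. *)
Definition tuples (k : nat) : set {mset tree_pair}%mset :=
  [set m | size m = k].

Definition sph_max (k n : nat) : set {mset tree_pair}%mset :=
  [set m | tuples k m /\ (\max_(t <- m) tree_pair_size t)%N = n].

Lemma finite_carets n : finite_set [set t : btree | (carets t <= n)%N].
Proof.
elim: n => [|n IH].
  by apply: (@sub_finite_set _ _ [set Leaf]) => [[]|]//; exact: finite_set1.
pose A := [set t : btree | (carets t <= n)%N].
apply: (@sub_finite_set _ _ ([set Leaf] `|` (fun q => Caret q.1 q.2) @` (A `*` A))).
  case=> [_|l r /= lr]; [by left|right; exists (l, r) => //].
  rewrite ltnS in lr; split; apply: leq_trans lr; [exact: leq_addr|exact: leq_addl].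
rewrite finite_setU; split; first exact: finite_set1.
exact/finite_image/finite_setX.
Qed.

Lemma finite_tree_pair n :
  finite_set [set t : tree_pair | (tree_pair_size t <= n)%N].
Proof.
pose A := [set t : btree | (carets t <= n)%N].
apply: (@sub_finite_set _ _ ((val : tree_pair -> _) @^-1` (A `*` A))).
  move=> -[[S T] /= h]; rewrite /tree_pair_size /= => Sn; split=> //=.
  by case/and3P: h => /= /eqP; rewrite /A /= => <-.
apply: finite_preimage; first by move=> x y _ _; exact: val_inj.
by apply: finite_setX; exact: finite_carets.
Qed.

Lemma finite_seqs (T : Type) (A : set T) k : finite_set A ->
  finite_set [set s : seq T | size s = k /\ forall i x0, (i < k)%N -> A (nth x0 s i)].
Proof.
move=> fA; elim: k => [|k IH].
  by apply: (@sub_finite_set _ _ [set [::]]) => [[|? ?] []|]//; exact: finite_set1.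
set B := (X in finite_set X) in IH.
apply: (@sub_finite_set _ _ ((fun q => q.1 :: q.2) @` (A `*` B))).
  case=> [[]//|x s [[sk] h]]; exists (x, s) => //; split=> /=; first exact: (h 0%N x).
  by split=> // i x0 ik; exact: (h i.+1).
exact/finite_image/finite_setX.
Qed.

Lemma finite_sph_max k n : finite_set (sph_max k n).
Proof.
pose A := [set t : tree_pair | (tree_pair_size t <= n)%N].
have := @finite_seqs _ A k (finite_tree_pair n).
move=> fB; apply: sub_finite_set (finite_image (@seq_mset _) fB) => m [mk mn].
exists (enum_mset m); last exact: seq_mset_id.
split=> // i x0 ik; rewrite /A /= -mn; apply: (leq_bigmax_seq (F := tree_pair_size)) => //.
by apply: mem_nth; rewrite mk.
Qed.

Definition has_density_max {R : realType} (k : nat)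
    (T : set {mset tree_pair}%mset) (d : R) : Prop :=
  (#|` fset_set (T `&` sph_max k n)|%fset%:R /
   #|` fset_set (sph_max k n)|%fset%:R : R) @[n --> \oo] --> d.

(* Every tree pair represents exactly one element of the group, so the set
   below consists of the coordinates of [m]. *)
Definition generating_tuples {R : realType} (k : nat) (H : set (thompson R)) :
  set {mset tree_pair}%mset :=
  [set m | tuples k m /\
    isomorphic
      (generated [set f : thompson R | exists2 t, t \in m & represents t f]) H].

Definition visible_max {R : realType} (k : nat) (H : set (thompson R)) : Prop :=
  exists2 d : R, has_density_max k (generating_tuples k H) d & 0 < d.

(* The class of the subgroups of F isomorphic to a given group. *)
Definition iso_class {R : realType} {G : groupType} (H : set G) :
  set (set (thompson R)) :=
  [set K | subgroup K /\ isomorphic K H].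

Definition spec_max (R : realType) (k : nat) : set (set (set (thompson R))) :=
  [set C | exists H : set (thompson R),
    [/\ subgroup H, visible_max k H & C = iso_class H]].
Arguments spec_max R k : clear implicits.

Definition Z_class (R : realType) : set (set (thompson R)) :=
  iso_class [set: Algebra.to_multiplicative int].
Arguments Z_class R : clear implicits.

(* Main.v *)
Require Import Defs.
From mathcomp Require Import all_boot all_order all_algebra.
From mathcomp Require Import finmap multiset.
From mathcomp Require Import all_classical all_reals all_analysis.
From mathcomp Require Import zify ring lra.

(** When [k = 1], a reduced tree pair with at least two carets represents a
    nontrivial element, and F is torsion-free.  So beyond radius 1 every tuple
    generates an infinite cyclic group: the class of Z has density 1, and every
    other class has density 0.

    When [k >= 2], tuples generating an infinite cyclic group are rare.  Let such
    a tuple have maximal size [n], let [t] be an entry of size [n] and [t'] be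
    another entry; let them represent [f] and [g].  Both are powers of one
    element, so they fix the same initial interval [[0, p]]; write [2 ^ a] and
    [2 ^ c] for their slopes just to the right of [p], where [a] is nonzero.
    Then [g ^ a = f ^ c] ([common_power]).  Roots in F are unique
    ([thompson_root_inj]), because F is bi-ordered by the direction in which an
    element moves points near the first point that it moves.  So, given [t], the
    integer [c] determines [g], and hence [t'].  A leaf of a tree with [n] carets
    has depth at most [n], so the absolute value of [c] is at most [n], and [t']
    is one of linearly many tree pairs ([companion_code]).  On the other hand
    there are at least [2 ^ (n - 2)] reduced pairs of size [n] ([spine_pair]),
    and [t'] could be replaced by any of them without leaving the sphere.  Hence
    the proportion of these tuples in the sphere is at most a constant times
    [n / 2 ^ n] ([card_cyclic_tuples]), and the density of the class of Z is 0.

    The passage between tree pairs and elements rests on two facts: every tree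
    pair represents an element ([exists_represented]), and a reduced pair is
    determined by the element that it represents ([represents_inj]). *)

Set Implicit Arguments.
Unset Strict Implicit.
Unset Printing Implicit Defensive.

Local Open Scope classical_set_scope.

(** * Binary trees and the addresses of their leaves *)

(** A vertex is addressed by the turns that lead to it from the root, [true]
    being a turn to the right. *)
Fixpoint leaf_addresses (t : btree) : seq bitseq :=
  if t is Caret l r
  then [seq false :: u | u <- leaf_addresses l] ++
       [seq true :: u | u <- leaf_addresses r]
  else [:: [::]].

Fixpoint subtree (t : btree) (w : bitseq) : option btree :=
  match w, t with
  | [::], _ => Some t
  | b :: w', Caret l r => subtree (if b then r else l) w'
  | _ :: _, Leaf => None
  end.

Lemma leaves_carets t : leaves t = (carets t).+1.
Proof. by elim: t => //= l -> r ->; rewrite addnS addSn. Qed.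

Lemma size_leaf_addresses t : size (leaf_addresses t) = leaves t.
Proof. by elim: t => //= l IHl r IHr; rewrite size_cat !size_map IHl IHr. Qed.

Lemma cons_in_leaf_addresses l r b u :
  (b :: u \in leaf_addresses (Caret l r)) =
  (u \in leaf_addresses (if b then r else l)).
Proof.
have inj c : injective (cons c : bitseq -> bitseq) by move=> x y [].
have neq c x (s : seq bitseq) : (c :: x) \in [seq ~~ c :: u | u <- s] = false.
  by apply/mapP => -[y _ []]; case: c.
rewrite /= mem_cat; case: b.
  by rewrite (neq true) mem_map.
by rewrite (neq false) mem_map // orbF.
Qed.

Lemma nil_in_leaf_addresses l r : [::] \notin leaf_addresses (Caret l r).
Proof. by rewrite mem_cat negb_or; apply/andP; split; apply/mapP => -[]. Qed.

Lemma size_leaf_address t u : u \in leaf_addresses t -> (size u <= carets t)%N.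
Proof.
elim: t u => [|l IHl r IHr] [|b u]; rewrite ?inE //.
rewrite cons_in_leaf_addresses /= ltnS; case: b => [/IHr|/IHl] h.
  exact: leq_trans h (leq_addl _ _).
exact: leq_trans h (leq_addr _ _).
Qed.

Lemma nth_leaf_addresses t k :
  (k < leaves t)%N -> nth [::] (leaf_addresses t) k \in leaf_addresses t.
Proof. by rewrite -size_leaf_addresses; exact: mem_nth. Qed.

Lemma eq_tree_leaves t t' :
  (forall u, u \in leaf_addresses t -> u \in leaf_addresses t') -> t = t'.
Proof.
elim: t t' => [|l IHl r IHr] [|l' r'] h //.
- by have := h [::] (mem_head _ _); rewrite (negbTE (nil_in_leaf_addresses _ _)).
- have lv : (0 < leaves l)%N by rewrite leaves_carets.
  have := h (false :: nth [::] (leaf_addresses l) 0).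
  by rewrite cons_in_leaf_addresses nth_leaf_addresses // => /(_ isT).
- congr Caret; [apply: IHl|apply: IHr] => u hu.
    by rewrite -(cons_in_leaf_addresses _ r' false) h // cons_in_leaf_addresses.
  by rewrite -(cons_in_leaf_addresses l' _ true) h // cons_in_leaf_addresses.
Qed.

Lemma leaf_addresses_inj : injective leaf_addresses.
Proof. by move=> t t' e; apply: eq_tree_leaves => u; rewrite e. Qed.

(** Descending two distinct trees in parallel, they first part at a vertex which
    is a leaf of one and branches in the other. *)
Lemma eq_tree_interior t t' :
  (forall u l r, u \in leaf_addresses t -> subtree t' u <> Some (Caret l r)) ->
  (forall u l r, u \in leaf_addresses t' -> subtree t u <> Some (Caret l r)) ->
  t = t'.
Proof.
elim: t t' => [|l IHl r IHr] [|l' r'] h h' //.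
- by case: (h [::] l' r').
- by case: (h' [::] l r).
- congr Caret.
    apply: IHl => u x y hu; first by have /= := h (false :: u) x y;
      rewrite cons_in_leaf_addresses; exact.
    by have /= := h' (false :: u) x y; rewrite cons_in_leaf_addresses; exact.
  apply: IHr => u x y hu; first by have /= := h (true :: u) x y;
    rewrite cons_in_leaf_addresses; exact.
  by have /= := h' (true :: u) x y; rewrite cons_in_leaf_addresses; exact.
Qed.

Definition sibling_leaves (t : btree) (k : nat) (w : bitseq) : Prop :=
  [/\ (k.+1 < leaves t)%N,
      nth [::] (leaf_addresses t) k = rcons w false &
      nth [::] (leaf_addresses t) k.+1 = rcons w true].

Lemma nth_leaf_addressesl l r k : (k < leaves l)%N ->
  nth [::] (leaf_addresses (Caret l r)) k =
  false :: nth [::] (leaf_addresses l) k.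
Proof.
by move=> kl; rewrite /= nth_cat size_map size_leaf_addresses kl
  (nth_map [::]) ?size_leaf_addresses.
Qed.

Lemma nth_leaf_addressesr l r k : (k < leaves r)%N ->
  nth [::] (leaf_addresses (Caret l r)) (leaves l + k) =
  true :: nth [::] (leaf_addresses r) k.
Proof.
move=> kr; rewrite /= nth_cat size_map size_leaf_addresses ltnNge leq_addr /=.
by rewrite addKn (nth_map [::]) ?size_leaf_addresses.
Qed.

Lemma sibling_leavesl l r k w :
  sibling_leaves l k w -> sibling_leaves (Caret l r) k (false :: w).
Proof.
case=> kl e0 e1; split.
- by rewrite (leq_trans kl) //= leq_addr.
- by rewrite nth_leaf_addressesl ?e0 // ltnW.
- by rewrite nth_leaf_addressesl ?e1.
Qed.

Lemma sibling_leavesr l r k w :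
  sibling_leaves r k w -> sibling_leaves (Caret l r) (leaves l + k) (true :: w).
Proof.
case=> kr e0 e1; split.
- by rewrite /= -addnS ltn_add2l.
- by rewrite nth_leaf_addressesr ?e0 // ltnW.
- by rewrite -addnS nth_leaf_addressesr ?e1.
Qed.

Lemma exists_sibling_leaves l r : exists k w, sibling_leaves (Caret l r) k w.
Proof.
suff H t : t = Leaf \/ exists k w, sibling_leaves t k w.
  by case: (H (Caret l r)).
elim: t {l r} => [|l IHl r IHr]; [by left|right].
case: IHl => [->|[k [w h]]]; last first.
  by exists k, (false :: w); exact: sibling_leavesl.
case: IHr => [->|[k [w h]]]; last first.
  by exists (1 + k)%N, (true :: w); exact: (@sibling_leavesr Leaf).
by exists 0%N, [::].
Qed.

Lemma exists_sibling_leaves_below t w l r : subtree t w = Some (Caret l r) ->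
  exists k x, sibling_leaves t k (w ++ x).
Proof.
elim: t w => [|tl IHl tr IHr] [|b w] //=.
  by move=> _; exact: exists_sibling_leaves.
case: b => [/IHr|/IHl] [k [x h]].
  by exists (leaves tl + k)%N, x; exact: sibling_leavesr.
by exists k, x; exact: sibling_leavesl.
Qed.

Lemma exposedE k l r : exposed k (Caret l r) =
  if (l, r) is (Leaf, Leaf) then [:: k]
  else exposed k l ++ exposed (k + leaves l) r.
Proof. by case: l r => [|? ?] []. Qed.

(** Exposed carets can be read off the leaf addresses, so that sibling leaves
    seen through the represented map are exposed carets of the tree. *)
Lemma exposed_sibling_leaves m t k w :
  sibling_leaves t k w -> (m + k)%N \in exposed m t.
Proof.
elim: t m k w => [|l IHl r IHr] m k w; first by case.
move=> H; have [kt e0 e1] := H.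
have [kl|kl] := ltnP k (leaves l); last first.
- have kr : (k - leaves l < leaves r)%N by move: kt => /=; lia.
  have kr1 : ((k - leaves l).+1 < leaves r)%N by move: kt => /=; lia.
  have ek : k = (leaves l + (k - leaves l))%N by lia.
  have ek1 : k.+1 = (leaves l + (k - leaves l).+1)%N by lia.
  move: e0 e1; rewrite ek1 {1}ek !nth_leaf_addressesr //.
  case: w {H} => [|b w] [] // eb e0 [_ e1].
  have := IHr (m + leaves l)%N (k - leaves l)%N w.
  rewrite -addnA -ek exposedE => /(_ (And3 kr1 e0 e1)) h.
  by case: (l) (r) h => [|? ?] [|? ?] h //; rewrite mem_cat h orbT.
have [kl1|kl1] := ltnP k.+1 (leaves l).
  move: e0 e1; rewrite !nth_leaf_addressesl //.
  case: w {H} => [|b w] [] // eb e0 [_ e1].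
  have := IHl m k w (And3 kl1 e0 e1); rewrite exposedE => h.
  by case: (l) (r) h => [|? ?] [|? ?] h //; rewrite mem_cat h.
(* the two siblings lie in different halves, so they hang from the root *)
have ek1 : k.+1 = (leaves l + 0)%N by lia.
have r0 : (0 < leaves r)%N by rewrite leaves_carets.
move: e0 e1; rewrite ek1 nth_leaf_addressesr // nth_leaf_addressesl //.
case: w {H} => [[e0] [e1]|b w [<- _]] //.
have := nth_leaf_addresses kl; have := nth_leaf_addresses r0; rewrite e0 e1.
case: (l) ek1 => [|a b] ek1; last by rewrite (negbTE (nil_in_leaf_addresses _ _)).
case: (r) => [|a b].
  by move: ek1; rewrite addn0 => -[->] _ _; rewrite addn0 mem_head.
by rewrite (negbTE (nil_in_leaf_addresses _ _)).
Qed.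

Fixpoint spine (w : bitseq) : btree :=
  if w is b :: w' then
    if b then Caret Leaf (spine w') else Caret (spine w') Leaf
  else Caret Leaf Leaf.

Lemma carets_spine w : carets (spine w) = (size w).+1.
Proof. by elim: w => //= -[] w /= -> //; rewrite addn0. Qed.

Lemma exposed_spine k w : exposed k (spine w) = [:: (k + count id w)%N].
Proof.
elim: w k => [|b w IH] k; first by rewrite addn0.
have : spine w <> Leaf by case: (w) => [|[]].
have -> : spine (b :: w) =
    if b then Caret Leaf (spine w) else Caret (spine w) Leaf by [].
case: b; rewrite exposedE IH.
  by case: (spine w) => [/(_ erefl)|l r _] //=; rewrite -addnA.
by case: (spine w) => [/(_ erefl)|l r _].
Qed.

Lemma spine_inj : injective spine.
Proof.
have spineN w : spine w <> Leaf by case: w => [|[]].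
elim=> [|b w IH] [|b' w'] //=; [by case: b' => -[]; case: (w') => [|[]]
  |by case: b => -[]; case: (w) => [|[]]|].
case: b b' => -[] //.
- by case=> /IH ->.
- by case=> /esym /spineN.
- by case=> /spineN.
- by case=> /IH ->.
Qed.

Lemma spine_pair_reduced w : nonempty_reduced
  (spine (nseq (size w).+1 false), spine (true :: w)).
Proof.
rewrite /nonempty_reduced /unreduced !carets_spine size_nseq eqxx !exposed_spine.
by rewrite /= count_nseq mul0n !add0n orbF inE.
Qed.

(** Pairing a left spine with any path tree that first turns right separates
    the two exposed carets; this yields exponentially many reduced pairs. *)
Definition spine_pair (w : bitseq) : tree_pair :=
  exist (fun p => nonempty_reduced p) _ (spine_pair_reduced w).

Lemma size_spine_pair w : tree_pair_size (spine_pair w) = (size w).+2.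
Proof. by rewrite [LHS](carets_spine (nseq _ _)) size_nseq. Qed.

Lemma spine_pair_inj : injective spine_pair.
Proof. by move=> w w' /(congr1 (fun t => (val t).2)) /spine_inj []. Qed.

(** * Dyadic intervals and uniqueness of reduced tree pairs *)

Lemma leaves_tree_pair (t : tree_pair) : leaves (val t).1 = leaves (val t).2.
Proof.
by case: t => -[S T] /= /and3P[/= /eqP e _ _]; rewrite !leaves_carets e.
Qed.

Section AddressIntervals.
Context {R : realType}.
Import Order.TTheory GRing.Theory Num.Theory.
Local Open Scope ring_scope.
Implicit Types (u v w : bitseq) (f : thompson R) (x : unit_interval R).

(** The address of a standard dyadic interval is the binary expansion of its
    left end, and its depth is minus the logarithm of its width. *)
Fixpoint left_end u : R :=
  if u is b :: u' then (b%:R + left_end u') / 2 else 0.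

Definition width u : R := 2 ^- size u.

Lemma width_gt0 u : 0 < width u.
Proof. by rewrite invr_gt0 exprn_gt0. Qed.

Lemma width_neq0 u : width u != 0.
Proof. by rewrite gt_eqF ?width_gt0. Qed.

Lemma width_cons b u : width (b :: u) = width u / 2.
Proof. by rewrite /width /= exprS invfM mulrC. Qed.

Lemma width_cat u w : width (u ++ w) = width u * width w.
Proof. by rewrite /width size_cat exprD invfM. Qed.

Lemma left_end_cat u w :
  left_end (u ++ w) = left_end u + width u * left_end w.
Proof.
elim: u => [|b u IH]; first by rewrite add0r /width expr0 invr1 mul1r.
by rewrite cat_cons /= IH width_cons; field.
Qed.

Lemma left_end_ge0 u : 0 <= left_end u.
Proof. by elim: u => //= b u IH; rewrite divr_ge0 ?addr_ge0. Qed.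

Lemma right_end_le1 u : left_end u + width u <= 1.
Proof.
elim: u => [|b u IH]; first by rewrite add0r /width expr0 invr1.
have : b%:R <= 1 :> R by rewrite lern1 leq_b1.
by rewrite width_cons /=; lra.
Qed.

Lemma width_size u v : width u = width v -> size u = size v.
Proof.
move=> /invr_inj; apply: ieexprIn; rewrite ?ltr0n //.
by rewrite (eqr_nat R 2 1).
Qed.

Lemma address_inj u v : left_end u = left_end v -> width u = width v -> u = v.
Proof.
move=> + /width_size; elim: u v => [|b u IH] [|b' v] //= e [/IH {}IH].
have := left_end_ge0 u; have := left_end_ge0 v.
have := right_end_le1 u; have := right_end_le1 v.
have := width_gt0 u; have := width_gt0 v.
move=> h1 h2 h3 h4 h5 h6.
move: e; have [<- e|ne e] := eqVneq b b'.
  by rewrite IH //; move: (b%:R) e => c; lra.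
by exfalso; move: e; case: b b' ne {IH} => -[] //= _; lra.
Qed.

Lemma slopeE u v :
  width v / width u = 2 ^ ((size u)%:Z - (size v)%:Z).
Proof.
by rewrite expfzDr ?pnatr_eq0 // -exprnN -exprnP /width invrK [LHS]mulrC.
Qed.

Lemma dyadic_width u : dyadic (width u).
Proof. by exists 1, (size u); rewrite mul1r. Qed.

Lemma dyadic_left_end u : dyadic (left_end u).
Proof.
elim: u => [|b u IH]; first exact: dyadic0.
rewrite /= mulrC; apply: (dyadicZ (-1)); apply: dyadicD => //.
by exists b, 0%N; rewrite expr0 divr1.
Qed.

Lemma leaf_intervalsE t (a b : R) : leaf_intervals t a b =
  [seq (a + (b - a) * left_end u, a + (b - a) * (left_end u + width u))
     | u <- leaf_addresses t].
Proof.
elim: t a b => [|l IHl r IHr] a b.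
  by rewrite /= /width /= expr0 invr1; congr [:: (_, _)]; ring.
rewrite /= map_cat IHl IHr -!map_comp; congr (_ ++ _); apply: eq_map => u /=;
  by rewrite width_cons; congr pair; field.
Qed.

Lemma unit_leaf_intervalsE t : leaf_intervals t 0 1 =
  [seq (left_end u, left_end u + width u) | u <- leaf_addresses t] :> seq (R * R).
Proof.
by rewrite leaf_intervalsE; apply: eq_map => u; rewrite !add0r subr0 !mul1r.
Qed.

Lemma leaf_cover t (z : R) : 0 <= z < 1 ->
  exists2 u, u \in leaf_addresses t & left_end u <= z < left_end u + width u.
Proof.
elim: t z => [|l IHl r IHr] z hz.
  by exists [::]; rewrite // add0r /width expr0 invr1.
have [z2|z2] := ltP z (1 / 2).
  have [|u ul hu] := IHl (2 * z); first by apply/andP; split; lra.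
  exists (false :: u); first by rewrite cons_in_leaf_addresses.
  by rewrite width_cons /=; apply/andP; split; lra.
have [|u ul hu] := IHr (2 * z - 1); first by apply/andP; split; lra.
exists (true :: u); first by rewrite cons_in_leaf_addresses.
by rewrite width_cons /=; apply/andP; split; lra.
Qed.

(** The slope [width v / width u] makes the image of the interval addressed by
    [u] the whole interval addressed by [v]. *)
Definition address_map f u v : Prop :=
  forall x, left_end u <= \val x <= left_end u + width u ->
    \val (f x) = left_end v + width v / width u * (\val x - left_end u).

Lemma representsE (t : tree_pair) f : represents t f <->
  forall i, (i < leaves (val t).1)%N ->
    address_map f (nth [::] (leaf_addresses (val t).1) i)
                  (nth [::] (leaf_addresses (val t).2) i).
Proof.
have lv := leaves_tree_pair t.
have wE u : left_end u + width u - left_end u = width u.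
  by rewrite addrAC subrr add0r.
split=> h i hi; have := h i hi; rewrite !unit_leaf_intervalsE;
  rewrite !(nth_map [::]) ?size_leaf_addresses -?lv // => {}h x hx.
  by rewrite (h x hx) !wE.
by rewrite !wE (h x hx).
Qed.

Lemma address_map_cat f u v w :
  address_map f u v -> address_map f (u ++ w) (v ++ w).
Proof.
move=> h x; rewrite !left_end_cat !width_cat => /andP[x0 x1]; rewrite h; last first.
  have := left_end_ge0 w; have := right_end_le1 w; have := width_gt0 u => a b c.
  apply/andP; split; first by apply: le_trans x0; rewrite lerDl (mulr_ge0 (ltW a)).
  apply: le_trans x1 _; rewrite -addrA lerD2l -mulrDr.
  by rewrite ler_piMr // ltW.
by field; rewrite !width_neq0.
Qed.

Lemma address_map_inj f u v v' :
  address_map f u v -> address_map f u v' -> v = v'.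
Proof.
have a := left_end_ge0 u; have b := right_end_le1 u; have c := width_gt0 u.
have [x xE] : exists x : set_type (unit_interval R), \val x = left_end u.
  by apply: unitI_lift; lra.
have [y yE] : exists y : set_type (unit_interval R),
    \val y = left_end u + width u.
  by apply: unitI_lift; lra.
move=> h h'.
have := h x; rewrite h' xE ?lexx ?lerDl ?ltW // subrr !mulr0 !addr0 => /(_ isT) e.
have := h y; rewrite h' yE ?lexx ?lerDl ?ltW // addrAC subrr add0r.
rewrite !divfK ?width_neq0 // e => /(_ isT) /addrI e'.
exact: address_inj.
Qed.

Lemma represents_address (t : tree_pair) f u : represents t f ->
  u \in leaf_addresses (val t).1 ->
  exists2 v, v \in leaf_addresses (val t).2 & address_map f u v.
Proof.
move=> /representsE h hu; have hi := hu; rewrite -index_mem size_leaf_addresses in hi.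
exists (nth [::] (leaf_addresses (val t).2) (index u (leaf_addresses (val t).1))).
  by rewrite nth_leaf_addresses -?leaves_tree_pair.
by have := h _ hi; rewrite nth_index.
Qed.

(** If [f] is affine and dyadic on a whole branching vertex of the domain tree,
    then the sibling leaves found below that vertex go to sibling leaves of the
    range tree, and the pair can be reduced. *)
Lemma reduced_leaf_not_interior (t t' : tree_pair) f u l r :
  represents t f -> represents t' f -> u \in leaf_addresses (val t).1 ->
  subtree (val t').1 u <> Some (Caret l r).
Proof.
move=> ht ht' hu sub; have [v _ fuv] := represents_address ht hu.
have [k [x [kt e0 e1]]] := exists_sibling_leaves_below sub.
move: ht' => /representsE ht'.
have := ht' k.+1 kt; rewrite e1 -cats1 -catA => hk1.
have := ht' k (ltnW kt); rewrite e0 -cats1 -catA => hk0.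
have {}hk0 := address_map_inj hk0 (address_map_cat fuv).
have {}hk1 := address_map_inj hk1 (address_map_cat fuv).
have sib : sibling_leaves (val t').1 k (u ++ x) by [].
case: t' {ht'} sub kt e0 e1 hk0 hk1 sib => -[S' T'] /= red sub kt e0 e1 hk0 hk1 sib.
case/and3P: red => /= /eqP eST S0 /negP; apply.
have sib' : sibling_leaves T' k (v ++ x).
  split; first by move: kt; rewrite !leaves_carets eST.
    by rewrite hk0 -cats1 catA.
  by rewrite hk1 -cats1 catA.
(* a single caret branches only at the root, which is not a leaf of t *)
have S2 : (2 <= carets S')%N.
  rewrite ltnNge; apply/negP => S1.
  case: S' {kt e0 e1 sib eST} S0 sub S1 => // a b _ sub; rewrite ltnS leqn0 addn_eq0.
  case: a b sub => [|? ?] [|? ?] //.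
  case: u hu {fuv hk0 hk1} => [|[] [|? ?]] // hu _ _.
  case: t hu {ht} => -[[|? ?] T] /=; first by case/and3P.
  by move=> _; rewrite (negbTE (nil_in_leaf_addresses _ _)).
rewrite /unreduced /= S2 -eST S2; apply/hasP; exists k.
  exact: (exposed_sibling_leaves 0 sib).
exact: (exposed_sibling_leaves 0 sib').
Qed.

(** Of two reduced pairs for [f], neither domain tree branches at a leaf of the
    other, so the domain trees agree; [f] then sends each leaf to its partner in
    either range tree, so these agree too. *)
Lemma represents_inj (t t' : tree_pair) f :
  represents t f -> represents t' f -> t = t'.
Proof.
move=> ht ht'; apply: val_inj.
have eS : (val t).1 = (val t').1.
  apply: eq_tree_interior => u l r hu; first exact: (reduced_leaf_not_interior ht).
  exact: (reduced_leaf_not_interior ht').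
rewrite [val t]surjective_pairing [val t']surjective_pairing; congr pair => //.
apply: leaf_addresses_inj; apply: (@eq_from_nth _ [::]).
  by rewrite !size_leaf_addresses -!leaves_tree_pair eS.
move=> i; rewrite size_leaf_addresses -leaves_tree_pair => hi.
move: ht ht' => /representsE/(_ i hi) h /representsE/(_ i); rewrite -eS => /(_ hi).
exact: address_map_inj.
Qed.

End AddressIntervals.

(** * Every tree pair represents an element *)

Section RealizingTreePairs.
Context {R : realType}.
Import Order.TTheory GRing.Theory Num.Theory.
Import numFieldNormedType.Exports.
Local Open Scope ring_scope.
Implicit Types (s : seq (R * R)) (x y : R).

(** The piecewise linear map through the origin that stretches consecutive
    intervals of lengths [p.1] onto consecutive intervals of lengths [p.2], for
    [p] in [s].  Written as a sum of clamped linear maps it is visibly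
    continuous, and swapping the lengths inverts it. *)
Fixpoint stretch s x : R :=
  if s is p :: s' then
    p.2 / p.1 * Num.min (Num.max x 0) p.1 + stretch s' (x - p.1)
  else 0.

Definition positive_lengths s := {in s, forall p, 0 < p.1 /\ 0 < p.2}.

Definition swap_lengths s := [seq (p.2, p.1) | p <- s].

Lemma positive_lengths_cons p s : positive_lengths (p :: s) ->
  [/\ 0 < p.1, 0 < p.2 & positive_lengths s].
Proof.
move=> h; have [h1 h2] := h p (mem_head _ _).
by split=> // q hq; apply: h; rewrite inE hq orbT.
Qed.

Lemma positive_lengths_swap s :
  positive_lengths s -> positive_lengths (swap_lengths s).
Proof. by move=> h _ /mapP[p hp ->]; have [] := h p hp. Qed.

Lemma continuous_stretch s : continuous (stretch s : R -> R).
Proof.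
elim: s => [|p s IH] x /=; first exact: cst_continuous.
apply: cvgD.
  apply: cvgM; first exact: cvg_cst.
  apply: (@continuous_min R R (fun y => Num.max y 0) (cst p.1)); last exact: cst_continuous.
  by apply: (@continuous_max R R id (cst 0)); [exact: cvg_id|exact: cst_continuous].
apply: (@continuous_comp _ _ _ (fun x => x - p.1) (stretch s)); last exact: IH.
by apply: cvgB; [exact: cvg_id|exact: cvg_cst].
Qed.

Lemma stretch_nondecreasing s x y :
  positive_lengths s -> x <= y -> stretch s x <= stretch s y.
Proof.
elim: s x y => //= p s IH x y /positive_lengths_cons[p1 p2 hs] xy.
apply: lerD; last by apply: IH => //; rewrite lerD2r.
apply: ler_wpM2l; first by rewrite divr_ge0 ?ltW.
by rewrite le_min !ge_min lexx orbT andbT ge_max !le_max xy lexx !orbT.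
Qed.

Lemma stretch_le0 s x : positive_lengths s -> x <= 0 -> stretch s x = 0.
Proof.
elim: s x => //= p s IH x /positive_lengths_cons[p1 p2 hs] x0.
rewrite IH //; last by lra.
by rewrite (max_idPr x0) (min_idPl (ltW p1)) mulr0 addr0.
Qed.

Lemma stretch_ge0 s x : positive_lengths s -> 0 <= stretch s x.
Proof.
move=> hs; have [x0|/ltW x0] := leP x 0; first by rewrite stretch_le0.
by rewrite -(stretch_le0 hs (lexx 0)) stretch_nondecreasing.
Qed.

Lemma stretch_cons_le p s x : positive_lengths (p :: s) -> 0 <= x <= p.1 ->
  stretch (p :: s) x = p.2 / p.1 * x.
Proof.
move=> /positive_lengths_cons[p1 p2 hs] /andP[x0 x1] /=.
by rewrite stretch_le0 ?subr_le0 // (max_idPl x0) (min_idPl x1) addr0.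
Qed.

Lemma stretch_cons_ge p s x : positive_lengths (p :: s) -> p.1 <= x ->
  stretch (p :: s) x = p.2 + stretch s (x - p.1).
Proof.
move=> /positive_lengths_cons[p1 p2 hs] x1 /=.
rewrite (max_idPl (le_trans (ltW p1) x1)) (min_idPr x1) divfK //.
by rewrite gt_eqF.
Qed.

Lemma stretch_total s : positive_lengths s ->
  stretch s (\sum_(p <- s) p.1) = \sum_(p <- s) p.2.
Proof.
elim: s => [|p s IH] hs; first by rewrite !big_nil.
have [p1 p2 hs'] := positive_lengths_cons hs.
rewrite !big_cons stretch_cons_ge //; first by rewrite (addrAC p.1) subrr add0r IH.
by rewrite lerDl big_seq sumr_ge0 // => q /hs' [/ltW].
Qed.

Lemma stretch_swapK s x : positive_lengths s -> 0 <= x <= \sum_(p <- s) p.1 ->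
  stretch (swap_lengths s) (stretch s x) = x.
Proof.
elim: s x => [|p s IH] x hs; first by rewrite big_nil /= => /le_anti.
have [p1 p2 hs'] := positive_lengths_cons hs.
have hsw := positive_lengths_swap hs.
rewrite big_cons => /andP[x0 xs]; have [xp|/ltW xp] := leP x p.1.
  rewrite stretch_cons_le ?x0 //.
  rewrite [swap_lengths _]/= stretch_cons_le //=; first by field; rewrite !gt_eqF.
  have p12 : 0 <= p.2 / p.1 by rewrite divr_ge0 // ltW.
  by rewrite (mulr_ge0 p12 x0) /= mulrAC ler_pdivrMr // ler_pM2l.
rewrite (stretch_cons_ge hs xp) [swap_lengths _]/= stretch_cons_ge //=.
  rewrite addrAC subrr add0r IH //; last by apply/andP; split; lra.
  by rewrite addrC subrK.
by rewrite lerDl stretch_ge0.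
Qed.

Lemma stretch_nth s i x : positive_lengths s -> (i < size s)%N ->
  \sum_(p <- take i s) p.1 <= x <= \sum_(p <- take i.+1 s) p.1 ->
  stretch s x = \sum_(p <- take i s) p.2 +
    (nth (0, 0) s i).2 / (nth (0, 0) s i).1 * (x - \sum_(p <- take i s) p.1).
Proof.
elim: s i x => [|p s IH] // i x hs.
have tk k : take k.+1 (p :: s) = p :: take k s by [].
case: i => [|i] hi.
  rewrite tk !take0 big_seq1 !big_nil add0r subr0.
  exact: stretch_cons_le.
have [p1 p2 hs'] := positive_lengths_cons hs.
rewrite !tk !big_cons => /andP[x0 x1].
have s0 : 0 <= \sum_(q <- take i s) q.1.
  by rewrite big_seq sumr_ge0 // => q /mem_take /hs' [/ltW].
rewrite stretch_cons_ge //; last by lra.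
by rewrite (IH i) //; [rewrite addrA opprD addrA|apply/andP; split; lra].
Qed.

Definition leaf_widths (t : btree) : seq R := [seq width u | u <- leaf_addresses t].

Lemma sum_leaf_widths t : \sum_(w <- leaf_widths t) w = 1.
Proof.
elim: t => [|l IHl r IHr]; first by rewrite /leaf_widths /= big_seq1 /width invr1.
rewrite /leaf_widths in IHl IHr *; rewrite /= map_cat big_cat -!map_comp /=.
rewrite !big_map in IHl IHr *.
under eq_bigr do rewrite /= width_cons.
under [X in _ + X]eq_bigr do rewrite /= width_cons.
by rewrite -!mulr_suml IHl IHr; lra.
Qed.

(** The leaf intervals lie side by side, from left to right. *)
Lemma left_end_nth t i : (i < leaves t)%N ->
  \sum_(w <- take i (leaf_widths t)) w = left_end (nth [::] (leaf_addresses t) i).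
Proof.
elim: t i => [|l IHl r IHr] i hi; first by case: i hi => // _; rewrite big_nil.
rewrite /leaf_widths /= map_cat -!map_comp take_cat size_map size_leaf_addresses.
have half (us : seq bitseq) : \sum_(w <- [seq width w / 2 | w <- us]) w =
    (\sum_(w <- [seq width w | w <- us]) w) / 2 :> R.
  by rewrite !big_map mulr_suml.
have eqm b (us : seq bitseq) :
    map (width \o cons b) us = [seq width w / 2 | w <- us] :> seq R.
  by apply: eq_map => u /=; rewrite width_cons.
have [il|il] := ltnP i (leaves l).
  rewrite nth_leaf_addressesl // eqm -map_take half map_take.
  by rewrite -/(leaf_widths l) IHl //= add0r.
have hr : (i - leaves l < leaves r)%N by move: hi => /=; lia.
rewrite big_cat /= -[in RHS](subnKC il) nth_leaf_addressesr // !eqm -map_take !half.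
by rewrite map_take -!/(leaf_widths _) IHr // sum_leaf_widths /= mulrDl.
Qed.

Definition tree_lengths (S T : btree) := zip (leaf_widths S) (leaf_widths T).

Lemma positive_tree_lengths S T :
  leaves S = leaves T -> positive_lengths (tree_lengths S T).
Proof.
move=> e p hp; have sz : size (leaf_widths S) = size (leaf_widths T).
  by rewrite !size_map !size_leaf_addresses.
split; [have := map_f fst hp|have := map_f snd hp].
  by rewrite [map _ _]unzip1_zip ?sz // => /mapP[u _ ->]; exact: width_gt0.
by rewrite [map _ _]unzip2_zip ?sz // => /mapP[u _ ->]; exact: width_gt0.
Qed.

Lemma tree_lengths1 S T : leaves S = leaves T ->
  map fst (tree_lengths S T) = leaf_widths S.
Proof.
by move=> e; rewrite [LHS]unzip1_zip // !size_map !size_leaf_addresses e.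
Qed.

Lemma swap_tree_lengths S T : swap_lengths (tree_lengths S T) = tree_lengths T S.
Proof.
rewrite /swap_lengths /tree_lengths.
by elim: (leaf_widths S) (leaf_widths T) => [|a s IH] [|b s'] //=; rewrite IH.
Qed.

Lemma tree_lengths2 S T : leaves S = leaves T ->
  map snd (tree_lengths S T) = leaf_widths T.
Proof.
by move=> e; rewrite [LHS]unzip2_zip // !size_map !size_leaf_addresses e.
Qed.

(** Both lists of leaf widths have total length 1, which makes the stretching
    map a bijection of the unit interval. *)
Lemma stretch_tree_total S T :
  leaves S = leaves T -> \sum_(p <- tree_lengths S T) p.1 = 1.
Proof.
move=> e; rewrite -(big_map fst xpredT id) tree_lengths1 //.
exact: sum_leaf_widths.
Qed.

Lemma stretch_tree_leaf S T i x (u := nth [::] (leaf_addresses S) i)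
    (v := nth [::] (leaf_addresses T) i) :
  leaves S = leaves T -> (i < leaves S)%N ->
  left_end u <= x <= left_end u + width u ->
  stretch (tree_lengths S T) x =
    left_end v + width v / width u * (x - left_end u).
Proof.
move=> e iS xu.
have nthw t : (i < leaves t)%N ->
    nth 0 (leaf_widths t) i = width (nth [::] (leaf_addresses t) i).
  by move=> it; rewrite (nth_map [::]) // size_leaf_addresses.
have szw t : size (leaf_widths t) = leaves t.
  by rewrite size_map size_leaf_addresses.
have szt : size (tree_lengths S T) = leaves S.
  by rewrite size_zip !szw -e minnn.
have sum1 k : \sum_(p <- take k (tree_lengths S T)) p.1 =
    \sum_(w <- take k (leaf_widths S)) w.
  by rewrite -(big_map fst xpredT id) map_take tree_lengths1.
have sum2 k : \sum_(p <- take k (tree_lengths S T)) p.2 =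
    \sum_(w <- take k (leaf_widths T)) w.
  by rewrite -(big_map snd xpredT id) map_take tree_lengths2.
rewrite (@stretch_nth _ i) ?szt //; first last.
- rewrite !sum1 (take_nth 0) ?szw // -cats1 big_cat big_seq1 /=.
  by rewrite left_end_nth // nthw.
- exact: positive_tree_lengths.
rewrite sum1 sum2 !left_end_nth -?e // /tree_lengths nth_zip ?szw //=.
by rewrite !nthw -?e.
Qed.

Lemma exists_represented (t : tree_pair) : exists f : thompson R, represents t f.
Proof.
have mem S T : leaves S = leaves T -> forall x : unit_interval R,
    stretch (tree_lengths S T) (\val x) \in unit_interval R.
  move=> e x; have pl := positive_tree_lengths e.
  rewrite inE /unit_interval /= in_itv /= stretch_ge0 //=.
  have tot : stretch (tree_lengths S T) 1 = 1.
    rewrite -[X in stretch _ X](stretch_tree_total e) stretch_total //.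
    by rewrite -(stretch_tree_total (esym e)) -(swap_tree_lengths S T) big_map.
  apply: le_trans (_ : stretch (tree_lengths S T) 1 <= 1); last by rewrite tot.
  by rewrite stretch_nondecreasing //; case/andP: (unitIP x).
pose F S T (e : leaves S = leaves T) (x : unit_interval R) : unit_interval R :=
  Sub (stretch (tree_lengths S T) (\val x)) (mem S T e x).
have FE S T (e : leaves S = leaves T) (x : unit_interval R) :
    \val (F S T e x) = stretch (tree_lengths S T) (\val x) by rewrite SubK.
have FK S T (e : leaves S = leaves T) : cancel (F S T e) (F T S (esym e)).
  move=> x; apply: val_inj; rewrite !FE -swap_tree_lengths stretch_swapK //.
    exact: positive_tree_lengths.
  by rewrite stretch_tree_total ?unitIP.
have Fc S T (e : leaves S = leaves T) : continuous (F S T e).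
  apply: continuous_comp_initial => x.
  have -> : (set_val \o F S T e) = stretch (tree_lengths S T) \o set_val.
    by apply/funext => y /=; rewrite -FE.
  apply: continuous_comp; first exact: initial_continuous.
  exact: continuous_stretch.
have e := leaves_tree_pair t; set S := (val t).1 in e; set T := (val t).2 in e.
have leafE u : u \in leaf_addresses S -> exists v, forall x : unit_interval R,
    left_end u <= \val x <= left_end u + width u -> \val (F S T e x) =
      left_end v + width v / width u * (\val x - left_end u).
  move=> hu; have hi := hu; rewrite -index_mem size_leaf_addresses in hi.
  exists (nth [::] (leaf_addresses T) (index u (leaf_addresses S))).
  by move=> x hx; rewrite FE (stretch_tree_leaf e hi) nth_index.
have Ft : in_thompson (F S T e).
  split.
  - split; first exact: Fc.
    exists (F T S (esym e)); split; [exact: Fc|exact: FK|].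
    move=> x; have := FK T S (esym e) x.
    by rewrite (Prop_irrelevance (esym (esym e)) e).
  - move=> x y xy; rewrite lt_neqAle !FE stretch_nondecreasing ?andbT ?ltW //.
      rewrite -!FE; apply/eqP => /val_inj/(can_inj (FK S T e)) exy.
      by rewrite exy ltxx in xy.
    exact: positive_tree_lengths.
  exists [seq left_end u + width u | u <- leaf_addresses S]; split.
    move=> _ /mapP[u _ ->]; apply: dyadicD; first exact: dyadic_left_end.
    exact: dyadic_width.
  move=> x y; rewrite le_eqVlt => /orP[/eqP/val_inj -> _|xy nb].
    exists 0, (\val (F S T e y) - \val y) => z /le_anti/val_inj <-.
    by rewrite expr0z mul1r addrC subrK.
  have [|u hu /andP[ux xu]] := @leaf_cover R S (\val x).
    have /andP[-> _] := unitIP x; have /andP[_ y1] := unitIP y.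
    exact: lt_le_trans y1.
  have yu : \val y <= left_end u + width u.
    rewrite leNgt; apply/negP => yu.
    have /negP := nb _ (map_f (fun u => left_end u + width u) hu).
    by apply; rewrite xu yu.
  have [v hv] := leafE u hu; exists ((size u)%:Z - (size v)%:Z).
  exists (left_end v - width v / width u * left_end u) => z /andP[xz zy].
  rewrite hv ?(le_trans ux) ?(le_trans zy) // -slopeE mulrBr addrC addrAC.
  by rewrite addrA.
exists (Thompson Ft); apply/representsE => i hi x hx.
by rewrite [LHS]FE (stretch_tree_leaf e hi).
Qed.

End RealizingTreePairs.

(** * Slope at the first moved point, and uniqueness of roots *)

Section UniqueRoots.
Local Open Scope group_scope.

(** Roots are unique in a bi-ordered group: if [x] is larger than [y], then each
    power of [x] is larger than the same power of [y].  Here the order is given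
    by its cone [P] of positive elements. *)
Lemma unique_roots (G : groupType) (P : G -> Prop) :
    ~ P 1 -> (forall x y, P x -> P y -> P (x * y)) ->
    (forall x y, P x -> P (x ^ y)) -> (forall x, x <> 1 -> P x \/ P x^-1) ->
  forall n (x y : G), (0 < n)%N -> x ^+ n = y ^+ n -> x = y.
Proof.
move=> P1 PM PJ PT n x y n0 exy.
have PX a b : P (b^-1 * a) -> forall m, P (b ^- m.+1 * a ^+ m.+1).
  move=> Pab m; elim: m => [|m IH]; first by rewrite !expg1.
  have -> : b ^- m.+2 * a ^+ m.+2 = (b ^- m.+1 * a ^+ m.+1) ^ b * (b^-1 * a).
    by rewrite (expgSr b m.+1) (expgSr a m.+1) invgM /conjg !mulgA mulgK.
  exact: PM (PJ _ _ IH) Pab.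
case: n n0 exy => // n _ exy; apply: contrapT => nxy.
have [|/PX|] := PT (y^-1 * x).
- by move=> /(congr1 ( *%g y)); rewrite mulgA mulgV mul1g mulg1.
- by move=> /(_ n); rewrite exy mulVg.
- by rewrite invgM invgK => /PX/(_ n); rewrite exy mulVg.
Qed.

End UniqueRoots.

Section FirstSlope.
Context {R : realType}.
Import Order.TTheory GRing.Theory Num.Theory.
Local Open Scope ring_scope.
Local Notation I := (set_type (unit_interval R)).
Implicit Types (f g : thompson R) (x z : I) (p y : R) (e : int).

(** To the left of [p] nothing moves, and just to its right [f] has slope
    [2 ^ e].  The value [e = 0] is allowed, so that for a fixed [p] the exponent
    is additive under composition; when it is not 0, [p] is the first point from
    which [f] moves anything. *)
Definition first_slope f p e : Prop :=
  [/\ 0 <= p < 1, forall x, \val x <= p -> f x = x &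
    exists2 y, p < y <= 1 & forall x, p <= \val x <= y ->
      \val (f x) = p + 2 ^ e * (\val x - p)].

Lemma thompson_invK f : cancel f (f^-1%g : thompson R).
Proof. by move=> x; exact: (congr1 (fun h : thompson R => h x) (mulVg f)). Qed.

Lemma thompson_invVK f : cancel (f^-1%g : thompson R) f.
Proof. by move=> x; exact: (congr1 (fun h : thompson R => h x) (mulgV f)). Qed.

Lemma exprz2_gt0 e : 0 < (2 : R) ^ e.
Proof. by rewrite exprz_gt0. Qed.

Lemma exprz2_inj : injective (exprz (2 : R)).
Proof. by apply: ieexprIz => //; rewrite (eqr_nat R 2 1). Qed.

Lemma first_slope1 p : 0 <= p < 1 -> first_slope 1%g p 0.
Proof.
move=> hp; split=> //; exists 1; first by case/andP: hp => _ ->; rewrite lexx.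
by move=> x _; rewrite expr0z mul1r addrC subrK.
Qed.

Lemma first_slopeM f g p e e' :
  first_slope f p e -> first_slope g p e' -> first_slope (f * g)%g p (e + e').
Proof.
move=> [hp fp [y /andP[py y1] fy]] [_ gp [y' /andP[py' y1'] gy]].
split=> // [x hx|]; first by rewrite /= gp // fp.
have e2 := exprz2_gt0 e'.
exists (Num.min y' (p + (y - p) / 2 ^ e')).
  rewrite lt_min py' ltrDl divr_gt0 ?subr_gt0 //=.
  by rewrite ge_min y1'.
move=> x /andP[px]; rewrite le_min => /andP[xy'].
rewrite -lerBlDl ler_pdivlMr // => xy.
have gx := gy x; rewrite px xy' in gx; have {}gx := gx isT.
rewrite /= fy gx.
  by rewrite addrAC subrr add0r expfzDr ?pnatr_eq0 // mulrA.
rewrite lerDl mulr_ge0 ?subr_ge0 ?(ltW e2) //=.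
by rewrite -lerBrDl mulrC.
Qed.

Lemma first_slopeV f p e : first_slope f p e -> first_slope f^-1%g p (- e).
Proof.
move=> [hp fp [y /andP[py y1] fy]].
have fK := thompson_invK f; have fVK := thompson_invVK f.
have [_ fm] := thompson_mono (thompsonP f).
have [fVl _] := thompson_mono (thompsonP f^-1%g).
case/andP: (hp) => p0 p1.
have [P PE] : exists P : I, \val P = p by apply: unitI_lift; rewrite p0 ltW.
have [Y YE] : exists Y : I, \val Y = y.
  by apply: unitI_lift; rewrite y1 (le_trans p0) // ltW.
split=> // [x xp|]; first by rewrite -[in LHS](fp x xp) fK.
exists (\val (f Y)).
  have /andP[_ ->] := unitIP (f Y); rewrite andbT fy ?YE ?lexx ?ltW //.
  by rewrite ltrDl mulr_gt0 ?exprz2_gt0 ?subr_gt0.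
move=> x /andP[px xy]; set z := _ x.
have zE : f z = x by rewrite fVK.
have hz : p <= \val z <= y.
  apply/andP; split; first by rewrite -PE -fm zE fp ?PE.
  by rewrite -YE -fm zE.
have := fy _ hz; rewrite zE => ->.
rewrite addrAC subrr add0r mulrA -expfzDr ?pnatr_eq0 //.
by rewrite addNr expr0z mul1r addrC subrK.
Qed.

Lemma first_slopeX f p e n :
  first_slope f p e -> first_slope (f ^+ n)%g p (e * n%:Z).
Proof.
move=> h; elim: n => [|n IH].
  by rewrite mulr0; apply: first_slope1; case: h.
by rewrite expgS -add1n PoszD mulrDr mulr1; exact: first_slopeM.
Qed.

Lemma first_slope_fun f p e e' :
  first_slope f p e -> first_slope f p e' -> e = e'.
Proof.
move=> [/andP[p0 _] _ [y /andP[py y1] fy]] [_ _ [y' /andP[py' y1'] fy']].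
have py2 : p < Num.min y y' by rewrite lt_min py py'.
have [z zE] : exists z : I, \val z = Num.min y y'.
  by apply: unitI_lift; rewrite ge_min y1 (le_trans p0 (ltW py2)).
have := fy z; rewrite fy' ?zE ?(ltW py2) ?ge_min ?lexx ?orbT //.
move=> /(_ isT) /addrI /mulIf h; apply: exprz2_inj; apply: esym; apply: h.
by rewrite subr_eq0 gt_eqF.
Qed.

(** A nonzero exponent prevents the fixed interval from extending beyond [p]; so
    [p] depends on [f] alone. *)
Lemma first_slope_le f p e p' e' : first_slope f p e -> e != 0 ->
  first_slope f p' e' -> p' <= p.
Proof.
move=> h e0 [/andP[p0' p1'] fp' _]; rewrite leNgt; apply/negP => pp'.
case/negP: e0; apply/eqP; apply: (first_slope_fun h).
case: h => hp fp [y /andP[py y1] fy]; split=> //; exists p'.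
  by rewrite pp' ltW.
by move=> x /andP[_ /fp' ->]; rewrite expr0z mul1r addrC subrK.
Qed.

(** The slope is the ratio of the widths of two leaves, and no leaf is deeper
    than the number of carets. *)
Lemma first_slope_size (t : tree_pair) f p e :
  represents t f -> first_slope f p e -> (`|e| <= tree_pair_size t)%N.
Proof.
move=> tf [hp fp [y /andP[py y1] fy]].
have [u hu /andP[up pu]] := leaf_cover (val t).1 hp.
have [v hv fuv] := represents_address tf hu.
case/andP: hp => p0 p1.
have [P PE] : exists P : I, \val P = p by apply: unitI_lift; rewrite p0 ltW.
pose r := Num.min y (left_end u + width u).
have pr : p < r by rewrite lt_min py.
have [Q QE] : exists Q : I, \val Q = r.
  by apply: unitI_lift; rewrite ge_min y1 (le_trans p0 (ltW pr)).
have hP := fuv P; rewrite fp PE ?lexx // up ltW // in hP; have {}hP := hP isT.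
have hQ := fuv Q; rewrite QE ge_min lexx orbT (le_trans up (ltW pr)) in hQ.
have {}hQ := hQ isT; have := fy Q.
rewrite hQ QE (ltW pr) ge_min lexx => /(_ isT) E.
have : 2 ^ e * (r - p) = 2 ^ ((size u)%:Z - (size v)%:Z) * (r - p).
  by rewrite -slopeE; move: (width v / width u) E hP => c E hP; lra.
move=> /mulIf; rewrite subr_eq0 (gt_eqF pr) => /(_ isT)/exprz2_inj ->.
have := size_leaf_address hu; have := size_leaf_address hv.
rewrite /tree_pair_size; case: t {tf hu hv fuv} => -[S T] /= /and3P[/= /eqP <- _ _].
lia.
Qed.

Lemma next_point (s : seq R) p : p < 1 ->
  exists2 y, p < y <= 1 & {in s, forall b, ~~ (p < b < y)}.
Proof.
move=> p1; elim: s => [|b s [y /andP[py y1] hy]].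
  by exists 1; rewrite ?p1 ?lexx.
have [pb|bp] := ltP p b; last first.
  exists y; first by rewrite py y1.
  by move=> c; rewrite inE => /orP[/eqP ->|/hy //]; rewrite ltNge bp.
exists (Num.min b y); first by rewrite lt_min pb py ge_min y1 orbT.
move=> c; rewrite inE lt_min => /orP[/eqP ->|/hy]; first by rewrite ltxx andbF.
by apply: contra => /and3P[-> _ ->].
Qed.

Lemma right_affine f x : \val x < 1 ->
  exists e : int, exists2 y, \val x < y <= 1 & forall z, \val x <= \val z <= y ->
    \val (f z) = \val (f x) + 2 ^ e * (\val z - \val x).
Proof.
move=> x1; have [_ _ [s [_ fs]]] := thompsonP f.
have [y /andP[xy y1] ys] := next_point s x1.
have [Y YE] : exists Y : I, \val Y = y.
  by apply: unitI_lift; rewrite y1 (le_trans _ (ltW xy)) //; case/andP: (unitIP x).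
have [||e [c ec]] := fs x Y; rewrite ?YE //; first exact: ltW.
exists e, y; rewrite ?xy // => z hz.
by rewrite !ec ?YE // ?lexx ?ltW //; ring.
Qed.

(** The point is the supremum of the initial intervals fixed by [f]: a slope 1 to
    its right would extend the fixed interval. *)
Lemma exists_first_slope f : f <> 1%g -> exists p e, e != 0 /\ first_slope f p e.
Proof.
move=> f1.
pose A := [set p : R | 0 <= p <= 1 /\ forall x, \val x <= p -> f x = x].
have A0 : A 0.
  split=> [|x x0]; first by rewrite lexx ler01.
  have xE : \val x = 0 by apply/eqP; rewrite eq_le x0; case/andP: (unitIP x).
  by apply: val_inj; rewrite xE; exact: thompson_0 (thompsonP f) xE.
have A1 : ubound A 1 by move=> p [/andP[]].
have supA : has_sup A by split; [exists 0|exists 1].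
have p0 : 0 <= sup A by apply: ub_le_sup => //; exists 1.
have p1 : sup A <= 1 by apply: ge_sup => //; exists 0.
have fix_lt x : \val x < sup A -> f x = x.
  by move=> /(sup_gt (ex_intro _ 0 A0)) [p [_ fp] xp]; exact/fp/ltW.
have [fl _] := thompson_mono (thompsonP f).
have fix_le x : \val x <= sup A -> f x = x.
  rewrite le_eqVlt => /orP[/eqP xE|]; last exact: fix_lt.
  (* if x moved, then f x or the preimage of x would be smaller, hence fixed *)
  apply: val_inj; have [fx|fx|//] := ltgtP (\val (f x)) (\val x).
    by have := fl (f x) x; rewrite fx fix_lt -?xE // ltxx.
  have gx : \val ((f^-1%g : thompson R) x) < \val x by rewrite -fl thompson_invVK.
  by have := gx; rewrite -[in ltRHS](thompson_invVK f x) fix_lt -?xE // ltxx.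
have psup : sup A < 1.
  rewrite lt_neqAle p1 andbT; apply/eqP => pE; apply: f1; apply: thompson_eq => x.
  by rewrite fix_le // pE; case/andP: (unitIP x).
have [P PE] : exists P : I, \val P = sup A by apply: unitI_lift; rewrite p0.
have [|e [y /andP[py y1] fy]] := @right_affine f P; first by rewrite PE.
exists (sup A), e; split; last first.
  split; rewrite ?p0 ?psup //; exists y; first by rewrite -PE py.
  by move=> x; rewrite -PE => /fy ->; rewrite fix_le ?PE.
apply/eqP => e0; rewrite PE in py.
have : y <= sup A; last by rewrite leNgt py.
apply: ub_le_sup; first by exists 1.
split; first by rewrite y1 (le_trans p0) // ltW.
move=> x xy; have [|px] := leP (\val x) (sup A); first exact: fix_le.
apply: val_inj; rewrite fy ?PE ?xy ?ltW // (fix_le P) ?PE // e0 expr0z mul1r.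
by rewrite addrC subrK.
Qed.

(** The cone of positive elements for a bi-order on the group: near the first
    point that it moves, the element moves points to the right.  An inequality is
    used instead of a slope because it is visibly preserved by conjugation. *)
Definition eventually_up f : Prop := exists a b : I,
  [/\ \val a < \val b, forall x, \val x <= \val a -> f x = x &
    forall x, \val a < \val x <= \val b -> \val x < \val (f x)].

Lemma eventually_up1 : ~ eventually_up 1%g.
Proof. by case=> a [b [ab _ /(_ b)]]; rewrite ab lexx ltxx => /(_ isT). Qed.

Lemma eventually_upM f g :
  eventually_up f -> eventually_up g -> eventually_up (f * g)%g.
Proof.
move=> [a [b [ab fa fb]]] [c [d [cd gc gd]]].
have [_ fm] := thompson_mono (thompsonP f); have [fl _] := thompson_mono (thompsonP f).
have [m mE] : exists m : I, \val m = Num.min (\val a) (\val c).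
  by case: (leP (\val a) (\val c)); [exists a|exists c].
have [n nE] : exists n : I, \val n = Num.min (\val b) (\val d).
  by case: (leP (\val b) (\val d)); [exists b|exists d].
have fge x : \val x <= \val b -> \val x <= \val (f x).
  move=> xb; have [/fa ->//|ax] := leP (\val x) (\val a).
  by rewrite ltW // fb // ax.
have gge x : \val x <= \val d -> \val x <= \val (g x).
  move=> xd; have [/gc ->//|cx] := leP (\val x) (\val c).
  by rewrite ltW // gd // cx.
exists m, n; rewrite mE nE; split.
- by rewrite gt_min !lt_min ab cd /=; case: (ltP (\val a) (\val d)) => //= da;
    rewrite (lt_le_trans cd) // (le_trans da) // ltW.
- by move=> x; rewrite le_min => /andP[xa xc] /=; rewrite gc // fa.
- move=> x; rewrite gt_min le_min => /andP[/orP[ax|cx] /andP[xb xd]] /=.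
    by apply: lt_le_trans (fb x _) _; rewrite ?ax // fm gge.
  by apply: le_lt_trans (fge x xb) _; rewrite fl gd // cx.
Qed.

Lemma eventually_upJ f g : eventually_up f -> eventually_up (f ^ g)%g.
Proof.
move=> [a [b [ab fa fb]]].
have [gl gm] := thompson_mono (thompsonP g).
have gK := thompson_invK g; have gVK := thompson_invVK g.
exists ((g^-1%g : thompson R) a), ((g^-1%g : thompson R) b); split.
- by rewrite -gl !gVK.
- move=> x; rewrite -gm gVK => xa.
  by rewrite -[RHS]gK -[X in _ = _ X](fa _ xa).
- move=> x; rewrite -gm -gl !gVK => xab.
  by rewrite -gl [X in _ < \val X]gVK fb.
Qed.

Lemma first_slope_up f p e : first_slope f p e -> 0 < e -> eventually_up f.
Proof.
move=> [/andP[p0 p1] fp [y /andP[py y1] fy]] e0.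
have [P PE] : exists P : I, \val P = p by apply: unitI_lift; rewrite p0 ltW.
have [Y YE] : exists Y : I, \val Y = y.
  by apply: unitI_lift; rewrite y1 (le_trans p0) // ltW.
exists P, Y; rewrite PE YE; split=> // x /andP[px xy].
rewrite fy ?xy ?ltW // -ltrBlDl ltr_pMl ?subr_gt0 //.
by case: e e0 {fy} => -[|n] // _; rewrite -exprnP exprn_egt1 ?ltr1n.
Qed.

Lemma eventually_up_total f :
  f <> 1%g -> eventually_up f \/ eventually_up f^-1%g.
Proof.
move=> /exists_first_slope [p [e [e0 he]]].
have [e1|e1|e1] := ltgtP 0 e; last by rewrite -e1 in e0.
  by left; exact: first_slope_up he e1.
by right; apply: first_slope_up (first_slopeV he) _; rewrite oppr_gt0.
Qed.

Lemma thompson_root_inj n f g : (0 < n)%N -> (f ^+ n)%g = (g ^+ n)%g -> f = g.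
Proof.
exact: (unique_roots eventually_up1 eventually_upM eventually_upJ
  eventually_up_total).
Qed.

End FirstSlope.

(** * Infinite cyclic subgroups *)

Section Isomorphisms.
Local Open Scope group_scope.
Implicit Types (G : groupType).

Lemma subgroupP G (H : set G) :
  subgroup H <-> H 1 /\ forall x y, H x -> H y -> H (x / y).
Proof.
split=> -[h1 h2]; split.
- by have := h1; rewrite inE.
- by move=> x y hx hy; have := h2 x y; rewrite !inE; exact.
- by rewrite inE.
- by move=> x y; rewrite !inE; exact: h2.
Qed.

Lemma subgroupM G (H : set G) x y : subgroup H -> H x -> H y -> H (x * y).
Proof.
move=> /subgroupP[h1 h2] hx hy; rewrite -(invgK y); apply: (h2) => //.
by rewrite -div1g; exact: h2.
Qed.

Lemma subgroupV G (H : set G) x : subgroup H -> H x -> H x^-1.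
Proof. by move=> /subgroupP[h1 h2] hx; rewrite -div1g; exact: h2. Qed.

Lemma subgroup_generated G (A : set G) : subgroup (generated A).
Proof.
apply/subgroupP; split; first by move=> K [/subgroupP[]].
move=> x y hx hy K HK; have [/subgroupP[_ h] _] := HK.
by apply: h; [exact: hx|exact: hy].
Qed.

Lemma subset_generated G (A : set G) : A `<=` generated A.
Proof. by move=> x Ax K [_]; exact. Qed.

Lemma isomorphic_refl G (H : set G) : isomorphic H H.
Proof.
exists id => //; split=> // x Hx; by exists x.
Qed.

Lemma isomorphic_trans G G' G'' (H : set G) (K : set G') (L : set G'') :
  isomorphic H K -> isomorphic K L -> isomorphic H L.
Proof.
move=> [phi [fun1 inj1 surj1] mor1] [psi [fun2 inj2 surj2] mor2].
exists (psi \o phi); last first.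
  move=> x y Hx Hy /=; rewrite mor1 // mor2 //; apply/mem_set/fun1; exact/set_mem.
split.
- by move=> x Hx; exact/fun2/fun1.
- move=> x y Hx Hy /inj2 e; apply: inj1 => //.
  by apply: e; apply/mem_set/fun1; exact/set_mem.
- move=> z /surj2 [y /surj1 [x Hx <-] <-]; by exists x.
Qed.

(** The map [phi] is multiplicative on [H] only, so the inverse is seen to be
    multiplicative by taking products inside [H]. *)
Lemma isomorphic_sym G G' (H : set G) (K : set G') :
  subgroup H -> isomorphic H K -> isomorphic K H.
Proof.
move=> sH [phi [fun1 inj1 surj1] mor1].
have inv y : exists x, K y -> H x /\ phi x = y.
  have [Ky|nKy] := pselect (K y); last by exists 1.
  by have [x Hx xE] := surj1 y Ky; exists x.
have [psi hpsi] := choice inv.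
have psiE y : K y -> H (psi y) by move=> /hpsi[].
have psiK y : K y -> phi (psi y) = y by move=> /hpsi[].
have phiK x : H x -> psi (phi x) = x.
  move=> Hx; have Kx := fun1 x Hx; apply: inj1; rewrite ?inE ?psiK //.
  exact: psiE.
exists psi; first split.
- by move=> y; exact: psiE.
- move=> y z /set_mem Ky /set_mem Kz e.
  by rewrite -(psiK y) // -(psiK z) // e.
- by move=> x Hx; exists (phi x); [exact: fun1|exact: phiK].
- move=> y z /set_mem Ky /set_mem Kz.
  rewrite -{1}(psiK y) // -{1}(psiK z) // -mor1 ?inE; [|exact: psiE..].
  by rewrite phiK //; apply: subgroupM => //; exact: psiE.
Qed.

Lemma iso_class_eq (R : realType) G G' (H : set G) (K : set G') :
  subgroup H -> isomorphic H K -> iso_class (R := R) H = iso_class K.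
Proof.
move=> sH HK; apply/seteqP; split=> L [sL LH]; split=> //.
  exact: isomorphic_trans HK.
by apply: isomorphic_trans LH _; exact: isomorphic_sym.
Qed.

End Isomorphisms.

Notation integers := [set: Algebra.to_multiplicative int].

Section CyclicSubgroups.
Import Order.TTheory GRing.Theory Num.Theory.
Local Open Scope ring_scope.
Context {G : groupType}.
Implicit Types (x y : G) (i j : int).

Lemma subgroup_integers : subgroup integers.
Proof. by apply/subgroupP. Qed.

Definition int_exp x i : G :=
  match i with Posz n => (x ^+ n)%g | Negz n => (x ^- n.+1)%g end.

Lemma int_exp1D x i : int_exp x (i + 1) = (int_exp x i * x)%g.
Proof.
case: i => [n|[|n]].
- by rewrite -[Posz n + 1]/(Posz (n + 1)) addn1 /= expgSr.
- by rewrite -[Negz 0 + 1]/(0%:Z) /= mulVg.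
have -> : Negz n.+1 + 1 = Negz n by rewrite !NegzE; lia.
by rewrite /= (expgS x n.+1) invgM mulgVK.
Qed.

Lemma int_expD x i j : int_exp x (i + j) = (int_exp x i * int_exp x j)%g.
Proof.
elim/int_rect: j => [|n IH|n IH]; first by rewrite addr0 mulg1.
  by rewrite -addn1 PoszD addrA !int_exp1D IH mulgA.
apply: (can_inj (mulgK x)); rewrite -mulgA -!int_exp1D -addrA.
by have -> : - n.+1%:Z + 1 = - n%:Z by lia.
Qed.

Variable phi : Algebra.to_multiplicative int -> G.
Hypothesis phiD : {in integers &, {morph phi : i j / (i * j)%g}}.

Lemma int_morphD i j : phi (i + j : int) = (phi i * phi j)%g.
Proof. by have := phiD (x := i) (y := j); rewrite !inE; exact. Qed.

Lemma int_morph0 : phi (0 : int) = 1%g.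
Proof. by apply: (mulgI (phi 0)); rewrite -int_morphD addr0 mulg1. Qed.

Lemma int_morphN i : phi (- i : int) = ((phi i)^-1)%g.
Proof. by apply: (mulgI (phi i)); rewrite -int_morphD subrr int_morph0 mulgV. Qed.

Lemma int_morphM i j : phi (i * j : int) = int_exp (phi i) j.
Proof.
have posM n : phi (i * n%:Z : int) = (phi i ^+ n)%g.
  elim: n => [|n IH]; first by rewrite mulr0 int_morph0.
  by rewrite -addn1 PoszD mulrDr mulr1 int_morphD IH addn1 expgSr.
case: j => n; first exact: posM.
by rewrite NegzE mulrN int_morphN posM.
Qed.

End CyclicSubgroups.

Section CyclicThompson.
Import Order.TTheory GRing.Theory Num.Theory.
Local Open Scope ring_scope.
Context {R : realType}.
Implicit Types (f g : thompson R) (K : set (thompson R)).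

(** The group is torsion-free, by uniqueness of roots of the identity. *)
Lemma int_exp_inj f : f <> 1%g -> injective (int_exp f).
Proof.
move=> f1 i j e; apply/eqP; rewrite -subr_eq0; apply/eqP.
have : int_exp f (i - j) = 1%g.
  apply: (can_inj (mulgK (int_exp f j))).
  by rewrite -int_expD subrK mul1g e.
case: (i - j) => [[|n]|n] //= h; case: f1; apply: (@thompson_root_inj _ n.+1) => //.
  by rewrite expg1n.
by rewrite expg1n; apply: invg_inj; rewrite invg1.
Qed.

Lemma integers_iso_generated f : f <> 1%g ->
  isomorphic integers (generated [set f]).
Proof.
move=> f1; exists (int_exp f); last by move=> i j _ _; exact: int_expD.
split.
- have sf := subgroup_generated [set f].
  have ff : generated [set f] f by exact: subset_generated.
  have fX n : generated [set f] (f ^+ n)%g.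
    elim: n => [|n IH]; first by case/subgroupP: sf.
    by rewrite expgS; exact: (subgroupM sf ff IH).
  by move=> [n|n] _ /=; [exact: fX|exact: (subgroupV sf (fX _))].
- by move=> i j _ _; exact: int_exp_inj.
- move=> g gen; have : range (int_exp f) g; last by move=> [i _ <-]; exists i.
  apply: gen; split; last by move=> _ ->; exists 1.
  apply/subgroupP; split; first by exists 0.
  move=> _ _ [i _ <-] [j _ <-]; exists (i - j) => //.
  by apply: (can_inj (mulgK (int_exp f j))); rewrite -int_expD subrK mulgVK.
Qed.

(** Let [f = h ^ i] and [g = h ^ j] for a generator [h] of [K] with slope
    [2 ^ b] at the first point that it moves.  There [f] has exponent [a = b * i]
    and [g] has exponent [c = b * j], so [g ^ a] and [f ^ c] are the same power
    of [h]. *)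
Lemma common_power K f g p (a : nat) : isomorphic integers K -> K f -> K g ->
  (0 < a)%N -> first_slope f p a ->
  exists2 c, first_slope g p c & (g ^+ a)%g = int_exp f c.
Proof.
move=> [phi [_ inj surj] mor].
have {}surj h : K h -> exists i : int, phi i = h by move=> /surj[i _ <-]; exists i.
move=> /surj[i iE] /surj[j jE] a0 fp.
have h1 : phi (1 : int) <> 1%g.
  by rewrite -(int_morph0 mor) => /inj; rewrite !inE => /(_ I I).
have [q [b [b0 hq]]] := exists_first_slope h1.
have hpow (l : int) : first_slope (phi l) q (b * l).
  rewrite -[l in phi l](mul1r l) int_morphM //; case: l => n /=.
    exact: first_slopeX.
  by rewrite NegzE mulrN; apply: first_slopeV; exact: first_slopeX.
have fq := hpow i; rewrite iE in fq.
have i0 : i != 0.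
  apply/eqP => i0; move: iE; rewrite i0 int_morph0 // => f1.
  have [hp _ _] := fp; rewrite -f1 in fp.
  by have [a00] := first_slope_fun fp (first_slope1 hp); rewrite a00 in a0.
have pq : p = q.
  apply/le_anti/andP; split.
    by apply: (first_slope_le fq _ fp); rewrite mulf_neq0.
  by apply: (first_slope_le fp _ fq); rewrite eqz_nat -lt0n.
rewrite -pq in fq; have aE := first_slope_fun fp fq.
exists (b * j); first by rewrite pq -jE.
have -> : (g ^+ a)%g = int_exp g a by [].
by rewrite -jE -iE -!int_morphM // aE mulrCA mulrA mulrC mulrA.
Qed.

End CyclicThompson.

(** * Tuples that generate an infinite cyclic subgroup are few *)

Section Companions.
Import Order.TTheory GRing.Theory Num.Theory.
Local Open Scope ring_scope.
Context {R : realType}.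
Implicit Types (f g : thompson R) (t : tree_pair).

Lemma single_caret_reduced :
  nonempty_reduced (Caret Leaf Leaf, Caret Leaf Leaf).
Proof. by []. Qed.

(** The identity already has the single caret as its reduced pair. *)
Lemma represents_not1 t f :
  (1 < tree_pair_size t)%N -> represents t f -> f <> 1%g.
Proof.
move=> t1 tf f1; rewrite f1 in tf.
pose c : tree_pair := exist (fun p => nonempty_reduced p) _ single_caret_reduced.
have cf : represents c (1%g : thompson R).
  apply/representsE => i _ x _; rewrite divff ?width_neq0 // mul1r.
  by rewrite addrC subrK.
by rewrite (represents_inj tf cf) in t1.
Qed.

Lemma thompson_fix1 f (x : unit_interval R) : \val x = 1 -> \val (f x) = 1.
Proof.
move=> x1; have [_ fm] := thompson_mono (thompsonP f).
apply/eqP; rewrite eq_le; have [_ ->] := andP (unitIP (f x)).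
rewrite -[X in X <= _]x1 -{1}(thompson_invVK f x) fm x1.
by have [_ ->] := andP (unitIP ((f^-1%g : thompson R) x)).
Qed.

Lemma represents_fun t f g : represents t f -> represents t g -> f = g.
Proof.
move=> tf tg; apply: thompson_eq => x; apply: val_inj.
have [x0] := andP (unitIP x); rewrite le_eqVlt => /orP[/eqP x1|x1].
  by rewrite !thompson_fix1.
have [|u hu /andP[ux xu]] := @leaf_cover R (val t).1 (\val x); first by rewrite x0.
have hi := hu; rewrite -index_mem size_leaf_addresses in hi.
move: tf tg => /representsE/(_ _ hi) fu /representsE/(_ _ hi) gu.
by rewrite fu ?gu // nth_index // ux ltW.
Qed.

Definition companions t t' : Prop := exists K : set (thompson R),
  [/\ subgroup K, isomorphic integers K &
      forall f, represents t f \/ represents t' f -> K f].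

(** A companion of a fixed nontrivial element is pinned down by its slope at the
    first point which that element moves, because roots are unique. *)
Lemma companion_code t : (1 < tree_pair_size t)%N -> exists code : tree_pair -> int,
  (forall t', companions t t' -> (`|code t'| <= tree_pair_size t')%N) /\
  (forall t' t'', companions t t' -> companions t t'' ->
     code t' = code t'' -> t' = t'').
Proof.
move=> t1; have [f tf] := @exists_represented R t.
have f1 := represents_not1 t1 tf.
have [h [p [a [a0 hp hK]]]] : exists (h : thompson R) (p : R) (a : nat),
    [/\ (0 < a)%N, first_slope h p a &
        forall K : set (thompson R), subgroup K -> K f -> K h].
  have [p [e [e0 fp]]] := exists_first_slope f1.
  (* an inverse makes the exponent a positive integer *)
  case: e e0 fp => [n|n] e0 fp; first by exists f, p, n; rewrite lt0n.
  exists (f^-1)%g, p, n.+1; split=> //; last by move=> K sK; exact: subgroupV.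
  by have := first_slopeV fp; rewrite NegzE opprK.
pose code t' := xget 0 [set c | exists g, [/\ represents t' g,
  first_slope g p c & (g ^+ a)%g = int_exp h c]].
have codeP t' : companions t t' -> exists g, [/\ represents t' g,
    first_slope g p (code t') & (g ^+ a)%g = int_exp h (code t')].
  move=> [K [sK iK KH]]; rewrite /code; case: xgetP => [c _ [g ?]|no]; first by exists g.
  have [g tg] := @exists_represented R t'.
  have Kf : K f by apply: KH; left.
  have Kg : K g by apply: KH; right.
  have [c gc gE] := common_power iK (hK K sK Kf) Kg a0 hp.
  by case: (no c); exists g.
exists code; split=> [t' /codeP[g [tg gp _]]|]; first exact: first_slope_size gp.
move=> t' t'' /codeP[g [tg _ gE]] /codeP[g' [tg' _ gE']] e.
have gg : g = g' by apply: (thompson_root_inj a0); rewrite gE gE' e.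
by rewrite gg in tg; exact: represents_inj tg tg'.
Qed.

Definition coordinates (m : {mset tree_pair}%mset) : set (thompson R) :=
  [set f | exists2 t, t \in m & represents t f].

Lemma generating_tuples_companions k (H : set (thompson R)) m t t' :
  subgroup H -> isomorphic H integers -> generating_tuples k H m ->
  t \in m -> t' \in m -> companions t t'.
Proof.
move=> sH HZ [_ iso] tm t'm.
have sG := subgroup_generated (coordinates m).
exists (generated (coordinates m)); split=> //.
  by apply: (isomorphic_sym sG); exact: isomorphic_trans HZ.
by move=> f [tf|tf]; apply: subset_generated; [exists t|exists t'].
Qed.

End Companions.

Section Replacement.
Local Open Scope mset_scope.

Lemma perm_msetD1 (K : choiceType) (a : K) (A : {mset K}) :
  perm_eq (a +` A) (a :: A).
Proof.
by rewrite -[in X in perm_eq X _](seq_mset_id A) -mset_cons perm_eq_seq_mset.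
Qed.

Lemma size_msetD1 (K : choiceType) (a : K) (A : {mset K}) :
  size (a +` A) = (size A).+1.
Proof. by rewrite (perm_size (perm_msetD1 a A)). Qed.

Lemma big_msetD1 (K : choiceType) (F : K -> nat) (a : K) (A : {mset K}) :
  (\max_(t <- a +` A) F t = maxn (F a) (\max_(t <- A) F t))%N.
Proof. by rewrite (perm_big _ (perm_msetD1 a A)) big_cons. Qed.

Lemma sph_max_split k n (m : {mset tree_pair}) : (1 < k)%N -> (0 < n)%N ->
  sph_max k n m -> exists t t' r,
    m = t +` (t' +` r) /\ tree_pair_size t = n.
Proof.
move=> k1 n0 [/= mk mn].
have m0 : (0 < size m)%N by rewrite mk ltnW.
have [t tm tn] : exists2 t, t \in m & tree_pair_size t = n.
  rewrite -mn big_tnth.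
  have m0' : (0 < #|'I_(size m)|)%N by rewrite card_ord.
  have [i ->] := eq_bigmax (fun i => tree_pair_size (tnth (in_tuple m) i)) m0'.
  by exists (tnth (in_tuple m) i); rewrite ?mem_tnth.
have mE := msetB1K tm; have := size_msetD1 t (m `\ t); rewrite mE mk => kE.
have [r0|[t' t'r]] := mset_0Vmem (m `\ t).
  by move: kE k1; rewrite r0 size_mset0 => ->.
by exists t, t', ((m `\ t) `\ t'); rewrite msetB1K // mE.
Qed.

Lemma sph_max_replace k n t t' s r : tree_pair_size t = n ->
  tree_pair_size s = n -> sph_max k n (t +` (t' +` r)) ->
  sph_max k n (t +` (s +` r)).
Proof.
move=> tn sn [mk]; rewrite !big_msetD1 tn => mn; split; last first.
  by rewrite !big_msetD1 tn sn; lia.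
have sz a : size (t +` (a +` r)) = (size r).+2.
  by rewrite (size_msetD1 t (a +` r)) (size_msetD1 a r).
have e := etrans (sz s) (esym (sz t')).
exact: etrans e mk.
Qed.

End Replacement.

Section Counting.
Import Order.TTheory GRing.Theory Num.Theory.
Local Open Scope mset_scope.
Context {R : realType}.
Local Open Scope nat_scope.

Lemma bounded_ints n : exists2 s : seq int,
  size s = 2 * n.+1 & forall i : int, `|i|%N <= n -> i \in s.
Proof.
exists ([seq Posz i | i <- iota 0 n.+1] ++ [seq Negz i | i <- iota 0 n.+1]).
  by rewrite size_cat !size_map !size_iota mul2n addnn.
move=> i; rewrite mem_cat; case: i => i ib; apply/orP; [left|right];
  by apply/mapP; exists i; rewrite // mem_iota; move: ib => /=; lia.
Qed.

(** In a tuple generating an infinite cyclic group, keep an entry [t] of full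
    size and replace another entry [t'] by any of the [2 ^ n] spine pairs.  The
    new tuple lies in the same sphere.  The positions of [t] and of the spine
    pair in it, together with the code of [t'], allow one to undo the
    replacement, so that the map to these data is injective. *)
Lemma card_cyclic_tuples k n (H : set (thompson R)) :
  1 < k -> subgroup H -> isomorphic H integers ->
  #|` fset_set (generating_tuples k H `&` sph_max k n.+2)|%fset * 2 ^ n <=
  #|` fset_set (sph_max k n.+2)|%fset * (k * (k * (2 * n.+3))).
Proof.
move=> k1 sH HZ.
set B := fset_set _; set S := fset_set _.
have inS m : (m \in S) <-> sph_max k n.+2 m.
  by rewrite in_fset_set ?inE //; exact: finite_sph_max.
have inB m : (m \in B) <-> (generating_tuples k H m /\ sph_max k n.+2 m).
  rewrite in_fset_set ?inE //.
  by apply: sub_finite_set (finite_sph_max k n.+2) => ? [].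
(* in each tuple fix an entry t of full size and another entry t' *)
have split_ex m : exists p : tree_pair * tree_pair * {mset tree_pair}, m \in B ->
    m = p.1.1 +` (p.1.2 +` p.2) /\ tree_pair_size p.1.1 = n.+2.
  have [/inB[_ /(sph_max_split k1 (ltn0Sn _))[t [t' [r e]]]]|nB] := boolP (m \in B).
    by exists (t, t', r).
  by exists (spine_pair [::], spine_pair [::], mset0).
have [sp spP] := choice split_ex.
pose big (m : {mset tree_pair}) := (sp m).1.1.
pose other (m : {mset tree_pair}) := (sp m).1.2.
pose rest (m : {mset tree_pair}) := (sp m).2.
have code_ex t : exists code : tree_pair -> int, 1 < tree_pair_size t ->
    (forall t', companions (R := R) t t' -> `|code t'| <= tree_pair_size t') /\
    (forall t' t'', companions (R := R) t t' -> companions (R := R) t t'' ->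
       code t' = code t'' -> t' = t'').
  have [t1|nt1] := boolP (1 < tree_pair_size t); last by exists (fun=> 0%R).
  by have [code hc] := companion_code (R := R) t1; exists code.
have [code codeP] := choice code_ex.
have spE m : m \in B -> big m +` (other m +` rest m) = m by move=> /spP[<-].
have big_sz m : m \in B -> tree_pair_size (big m) = n.+2 by move=> /spP[].
clearbody big other rest => {spP sp split_ex}.
pose words := [seq tval w | w <- enum {: n.-tuple bool}].
pose swap m w := big m +` (spine_pair w +` rest m).
pose enc (q : {mset tree_pair} * bitseq) :=
  (swap q.1 q.2, (index (big q.1) (swap q.1 q.2),
    (index (spine_pair q.2) (swap q.1 q.2), code (big q.1) (other q.1)))).
pose src := [seq (m, w) | m <- enum_fset B, w <- words].
have [ints size_ints mem_ints] := bounded_ints n.+2.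
pose tgt := [seq (m, q) | m <- enum_fset S, q <-
  [seq (i, q) | i <- iota 0 k, q <-
    [seq (j, c) | j <- iota 0 k, c <- ints]]].
have szw : size words = 2 ^ n by rewrite size_map -cardE card_tuple card_bool.
have -> : #|` B|%fset * 2 ^ n = size src by rewrite size_allpairs szw.
have -> : #|` S|%fset * (k * (k * (2 * n.+3))) = size tgt.
  by rewrite !size_allpairs !size_iota size_ints.
have wordsP w : w \in words -> size w = n.
  by move=> /mapP[v _ ->]; exact: size_tuple.
have swapP (m : {mset tree_pair}) w :
    m \in B -> w \in words -> sph_max k n.+2 (swap m w).
  move=> mB /wordsP wn; have [_ ms] := (inB m).1 mB.
  rewrite -(spE m mB) in ms; apply: sph_max_replace ms; first exact: big_sz.
  by rewrite size_spine_pair wn.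
have big_in (m : {mset tree_pair}) w : big m \in swap m w by rewrite mset1D1.
have spine_in (m : {mset tree_pair}) w : spine_pair w \in swap m w.
  by rewrite mset1Dr // mset1D1.
have big_mem (m : {mset tree_pair}) : m \in B -> big m \in m.
  by move=> mB; rewrite -[X in _ \in X](spE m mB) mset1D1.
have other_mem (m : {mset tree_pair}) : m \in B -> other m \in m.
  by move=> mB; rewrite -[X in _ \in X](spE m mB) mset1Dr // mset1D1.
have big_comp (m : {mset tree_pair}) : m \in B -> companions (R := R) (big m) (other m).
  move=> mB; have [mg _] := (inB m).1 mB.
  by apply: (generating_tuples_companions sH HZ mg); [exact: big_mem|exact: other_mem].
have big_size m : m \in B -> 1 < tree_pair_size (big m).
  by move=> mB; rewrite big_sz.
have other_size (m : {mset tree_pair}) : m \in B -> tree_pair_size (other m) <= n.+2.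
  move=> mB; have [_ [_ <-]] := (inB m).1 mB.
  exact: (leq_bigmax_seq (F := tree_pair_size)) (other_mem m mB) _.
rewrite -(size_map enc); apply: uniq_leq_size; last first.
  move=> _ /mapP[_ /allpairsP[[m w] /= [mB ww ->]] ->].
  have sz : size (swap m w) = k by have [] := swapP m w mB ww.
  apply/allpairsP; eexists (_, (_, (_, _))); split=> //=; first exact/inS/swapP.
  apply/allpairsP; eexists (_, (_, _)); split=> //=.
    by rewrite mem_iota /= add0n -sz index_mem big_in.
  apply/allpairsP; eexists (_, _); split=> //=.
    by rewrite mem_iota /= add0n -sz index_mem spine_in.
  apply: mem_ints; apply: leq_trans (other_size m mB).
  by have [h _] := codeP _ (big_size m mB); exact/h/big_comp.
have uniq_words : uniq words by rewrite map_inj_uniq ?enum_uniq //; exact: val_inj.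
rewrite map_inj_in_uniq.
  by apply: allpairs_uniq; [exact: fset_uniq| |move=> [? ?] [? ?]].
move=> _ _ /allpairsP[[m w] /= [mB ww ->]] /allpairsP[[m' w'] /= [mB' ww' ->]].
rewrite /enc /= => -[es eb ew ec].
have bb : big m = big m'.
  by rewrite -(nth_index (big m) (big_in m w)) eb es nth_index ?big_in.
have wE : w = w'.
  apply: spine_pair_inj.
  by rewrite -(nth_index (big m) (spine_in m w)) ew es nth_index ?spine_in.
have oo : other m = other m'.
  have [_ inj] := codeP _ (big_size m mB); apply: inj; first exact: big_comp.
    by rewrite bb; exact: big_comp.
  by rewrite [in RHS]bb.
have rr : rest m = rest m'.
  have := es; rewrite /swap bb wE => /(congr1 (fun A => A `\ big m')).
  by rewrite !msetD1K => /(congr1 (fun A => A `\ spine_pair w')); rewrite !msetD1K.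
by rewrite -(spE m mB) -(spE m' mB') bb oo rr wE.
Qed.

End Counting.

(** * Densities *)

Section Densities.
Import Order.TTheory GRing.Theory Num.Theory.
Import numFieldNormedType.Exports.
Local Open Scope ring_scope.
Context {R : realType}.
Implicit Types (H : set (thompson R)).

Lemma density_unique k (T : set {mset tree_pair}%mset) (d d' : R) :
  has_density_max k T d -> has_density_max k T d' -> d = d'.
Proof. exact: (@cvg_unique _ (@norm_hausdorff R R)). Qed.

Lemma sqr_le_expn n : ((n + 3) ^ 2 <= 16 * 2 ^ n)%N.
Proof. by elim: n => // n IH; move: IH; rewrite (expnS 2 n); nia. Qed.

(** In the sphere of radius [n + 2] the proportion is at most
    [2 * k ^ 2 * (n + 3) / 2 ^ n], and [16 * 2 ^ n] exceeds [(n + 3) ^ 2]. *)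
Lemma density_cyclic_tuples k H : (1 < k)%N -> subgroup H ->
  isomorphic H integers -> has_density_max k (generating_tuples k H) (0 : R).
Proof.
move=> k1 sH HZ; pose c := (32 * k * k)%N.
apply: (@squeeze_cvgr _ _ _ _ (cst 0) (fun n => c%:R * harmonic n : R)).
- exists 2%N => // -[|[|n]] // _ /=.
  set b := #|` _|%fset; set s := #|` _|%fset.
  rewrite divr_ge0 //=.
  have h : (b * 2 ^ n <= s * (k * (k * (2 * n.+3))))%N by exact: card_cyclic_tuples.
  have bs : (b * n.+3 <= c * s)%N.
    have := sqr_le_expn n; rewrite /c addn3 => n3.
    rewrite -(@leq_pmul2r n.+3) //.
    have : (b * n.+3 ^ 2 <= b * (16 * 2 ^ n))%N by rewrite leq_mul2l n3 orbT.
    lia.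
  have [->|s0] := eqVneq s 0%N.
    by rewrite invr0 mulr0 mulr_ge0 // invr_ge0.
  rewrite ler_pdivrMr ?ltr0n ?lt0n // mulrAC ler_pdivlMr ?ltr0n //.
  by rewrite -!natrM ler_nat.
- exact: cvg_cst.
- rewrite -[X in _ --> X](mulr0 c%:R); apply: cvgM; first exact: cvg_cst.
  exact: cvg_harmonic.
Qed.

Lemma sph_max1P n (m : {mset tree_pair}%mset) : sph_max 1 n m <->
  exists2 t, m = [mset t]%mset & tree_pair_size t = n.
Proof.
split.
  move=> [m1 mn].
  have [m0|[t tm]] := mset_0Vmem m.
    by move: m1; rewrite /tuples /mkset m0 size_mset0.
  have r0 : (m `\ t)%mset = mset0.
    apply/eqP; rewrite -size_mset_eq0; have := size_msetD1 t (m `\ t)%mset.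
    by rewrite msetB1K // => sz; have := etrans (esym sz) m1; case=> ->.
  have mE : m = [mset t]%mset by rewrite -(msetB1K tm) r0 msetD0.
  by exists t => //; rewrite -mn mE enum_msetn big_seq1.
move=> [t -> <-]; split.
  by rewrite /tuples /mkset enum_msetn.
by rewrite enum_msetn big_seq1.
Qed.

(** Beyond radius 1 every single tree pair represents a nontrivial element, which
    has infinite order. *)
Lemma generating_tuples1 n H m : (1 < n)%N -> subgroup H ->
  isomorphic H integers -> sph_max 1 n m -> generating_tuples 1 H m.
Proof.
move=> n1 sH HZ ms; split; first by case: ms.
have [t mt tn] := (sph_max1P n m).1 ms.
have [f tf] := @exists_represented R t.
have f1 : f <> 1%g by apply: represents_not1 tf; rewrite tn.
rewrite (_ : [set f | _] = [set f]); last first.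
  apply/seteqP; split=> [g [t']|_ ->]; last by exists t; rewrite // mt mset11.
  by rewrite mt => /mset1P -> tg; exact: represents_fun tg tf.
apply: isomorphic_trans (isomorphic_sym sH HZ).
apply: isomorphic_sym; first exact: subgroup_integers.
exact: integers_iso_generated.
Qed.

Lemma exists_infinite_cyclic : exists2 C : set (thompson R),
  subgroup C & isomorphic C integers.
Proof.
have [f tf] := @exists_represented R (spine_pair [::]).
have f1 : f <> 1%g by apply: represents_not1 tf; rewrite size_spine_pair.
exists (generated [set f]); first exact: subgroup_generated.
by apply: isomorphic_sym (integers_iso_generated f1); exact: subgroup_integers.
Qed.

Lemma visible_cyclic1 H : subgroup H -> isomorphic H integers ->
  visible_max 1 H.
Proof.
move=> sH HZ; exists 1 => //; apply: cvg_near_cst; exists 2%N => // -[|[|n]] // _ /=.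
have -> : generating_tuples 1 H `&` sph_max 1 n.+2 = sph_max 1 n.+2.
  by apply/seteqP; split=> m [] // *; split=> //; apply: (@generating_tuples1 n.+2).
rewrite divff // pnatr_eq0 cardfs_eq0; apply/eqP => /fsetP e.
have := e [mset spine_pair (nseq n false)]%mset.
rewrite in_fset0 in_fset_set; last exact: finite_sph_max.
rewrite mem_set //; apply/sph_max1P; exists (spine_pair (nseq n false)) => //.
by rewrite size_spine_pair size_nseq.
Qed.

(** Otherwise no tuple beyond radius 1 would generate a copy of [H]. *)
Lemma visible1_cyclic H : subgroup H -> visible_max 1 H -> isomorphic H integers.
Proof.
move=> sH [d hd d0]; apply: contrapT => nHZ.
have : d = 0; last by move=> e; rewrite e ltxx in d0.
apply: density_unique hd _; apply: cvg_near_cst; exists 2%N => // -[|[|n]] // _ /=.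
rewrite (_ : _ `&` _ = set0) ?fset_set0 ?cardfs0 ?mul0r //.
apply/seteqP; split=> // m [mg ms]; apply: nHZ.
have [C sC CZ] := exists_infinite_cyclic.
have [_ mC] := @generating_tuples1 n.+2 C m isT sC CZ ms.
case: mg => _ /isomorphic_sym h; apply: isomorphic_trans (h _) _.
  exact: subgroup_generated.
exact: isomorphic_trans CZ.
Qed.

Lemma not_visible_cyclic k H : (1 < k)%N -> subgroup H ->
  isomorphic H integers -> ~ visible_max k H.
Proof.
move=> k1 sH HZ [d hd].
by rewrite (density_unique hd (density_cyclic_tuples k1 sH HZ)) ltxx.
Qed.

End Densities.

Theorem theorem16 (R : realType) :
  spec_max R 1 = [set Z_class R] /\
  forall k : nat, (2 <= k)%N -> ~ spec_max R k (Z_class R).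
Proof.
split.
  apply/seteqP; split=> [C [H [sH vH ->]]|_ ->] /=.
    by apply: iso_class_eq => //; exact: visible1_cyclic.
  have [C sC CZ] := @exists_infinite_cyclic R.
  exists C; split=> //; first exact: visible_cyclic1.
  by apply: esym; exact: iso_class_eq.
move=> k k2 [H [sH vH e]].
have [_ HZ] : Z_class R H by rewrite e; split=> //; exact: isomorphic_refl.
exact: not_visible_cyclic k2 sH HZ vH.
Qed.
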